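(* Let $n\ge 3$ and $S\subseteq\{1,\dots,n-2\}$. If $S=\{1,2,\dots,i\}$ for some $0\le i\le n-2$ (with $i=0$ meaning $S=\emptyset$), then $b'_S(n)=1$; otherwise $b'_S(n)>1$.
   Context: $\Pi_n$ is the lattice of set partitions of $\{1,\dots,n\}$ ordered by refinement, with minimum $\hat 0$ (all singletons) and maximum $\hat 1$ (one block); the rank of a partition with $k$ blocks is $n-k$. The symmetric group $S_n$ acts on $\Pi_n$ by permuting $\{1,\dots,n\}$, and hence permutes chains. For $T\subseteq\{1,\dots,n-2\}$ let $\alpha_T$ be the permutation representation of $S_n$ (over $\mathbb{C}$) on the set of chains $\hat 0<x_1<\dots<x_m<\hat 1$ whose set of ranks is exactly $T$. For $S\subseteq\{1,\dots,n-2\}$ put $\beta_S=\sum_{T\subseteq S}(-1)^{|S-T|}\alpha_T$ (equivalently, the $S_n$-representation on the top reduced homology of the order complex of the rank-selected subposet $\Pi_n^S$ of elements with rank in $S$). Let $b'_S(n)$ be the multiplicity of the trivial representation of the Young subgroup $S_{n-1}\times S_1\subseteq S_n$ in the restriction of $\beta_S$ to $S_{n-1}\times S_1$. *)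

(* Defs.v *)
From HB Require Import structures.
From mathcomp Require Import all_boot all_order all_algebra all_fingroup.
From mathcomp Require Import all_field all_character.

Set Implicit Arguments.
Unset Strict Implicit.
Unset Printing Implicit Defensive.

Import Order.TTheory GRing.Theory Num.Theory GroupScope.
Local Open Scope ring_scope.

(* The points 1, ..., n are represented by 'I_n, the point k by the ordinal of
   value k - 1; in particular n is the ordinal of value n.-1. *)
Section SetPartitions.

Variable n : nat.

Record setpart := SetPart {
  blocks :> {set {set 'I_n}};
  blocks_partition : partition blocks [set: 'I_n]
}.

HB.instance Definition _ := [isSub for blocks].
HB.instance Definition _ := [Finite of setpart by <:].

Implicit Types P Q R : setpart.

Definition refines P Q :=
  [forall A in P, [exists B in Q, A \subset B]].

Lemma refinesP P Q :
  reflect (forall A, A \in P -> exists2 B, B \in Q & A \subset B)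
          (refines P Q).
Proof.
apply: (iffP forall_inP) => h A AP; first exact/exists_inP/h.
by apply/exists_inP/h.
Qed.

Lemma block_exists P (i : 'I_n) : exists2 A, A \in P & i \in A.
Proof.
have /and3P[/eqP cP _ _] := valP P.
by apply/bigcupP; rewrite -/(cover _) cP inE.
Qed.

Lemma block_nonempty P A : A \in P -> exists i, i \in A.
Proof.
have /and3P[_ _ n0] := valP P => AP.
by apply/set0Pn; apply: contraNneq n0 => <-.
Qed.

Lemma block_unique P A B i :
  A \in P -> B \in P -> i \in A -> i \in B -> A = B.
Proof.
have /and3P[_ tP _] := valP P => AP BP iA iB.
by rewrite -(def_pblock tP AP iA) (def_pblock tP BP iB).
Qed.

Fact refines_refl : reflexive refines.
Proof. by move=> P; apply/refinesP => A AP; exists A. Qed.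

Fact refines_anti : antisymmetric refines.
Proof.
have sub P Q : refines P Q -> refines Q P -> blocks P \subset Q.
  move=> /refinesP PQ /refinesP QP; apply/subsetP => A AP.
  have [B BQ AB] := PQ A AP; have [C CP BC] := QP B BQ.
  have [i iA] := block_nonempty AP.
  have AC : A = C by apply: (block_unique AP CP iA); apply/(subsetP BC)/(subsetP AB).
  suff -> : A = B by [].
  by apply/eqP; rewrite eqEsubset AB AC.
move=> P Q /andP[PQ QP]; apply/val_inj/eqP.
by rewrite eqEsubset !sub.
Qed.

Fact refines_trans : transitive refines.
Proof.
move=> Q P R /refinesP PQ /refinesP QR; apply/refinesP => A AP.
have [B BQ AB] := PQ A AP; have [C CR BC] := QR B BQ.
by exists C => //; apply: subset_trans BC.
Qed.

Fact refinement_display : Order.disp_t.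
Proof. exact: Order.Disp tt tt. Qed.

HB.instance Definition _ := @Order.Le_isPOrder.Build refinement_display setpart
  refines refines_refl refines_anti refines_trans.

Fact singletons_partition : partition [set [set i] | i : 'I_n] [set: 'I_n].
Proof.
apply/and3P; split.
- apply/eqP/setP => i; rewrite inE; apply/bigcupP.
  by exists [set i]; rewrite ?imset_f ?set11.
- apply/trivIsetP => _ _ /imsetP[i _ ->] /imsetP[j _ ->] ij.
  by rewrite disjoints1 inE; apply: contraNneq ij => ->.
- by apply/imsetP => -[i _ /setP/(_ i)]; rewrite !inE eqxx.
Qed.

Definition singletons : setpart := SetPart singletons_partition.

(* The set difference only matters for n = 0, where the one partition is
   empty. *)
Fact one_block_partition : partition ([set [set: 'I_n]] :\ set0) [set: 'I_n].
Proof.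
apply/and3P; split.
- apply/eqP/setP => i; rewrite inE; apply/bigcupP; exists [set: 'I_n] => //.
  by rewrite !inE eqxx andbT; apply/set0Pn; exists i.
- apply/trivIsetP => A B; rewrite !inE => /andP[_ /eqP->] /andP[_ /eqP->].
  by rewrite eqxx.
- by rewrite !inE eqxx.
Qed.

Definition one_block : setpart := SetPart one_block_partition.

Fact singletons_bottom P : (singletons <= P)%O.
Proof.
apply/refinesP => _ /imsetP[i _ ->]; have [A AP iA] := block_exists P i.
by exists A; rewrite ?sub1set.
Qed.

Fact one_block_top P : (P <= one_block)%O.
Proof.
apply/refinesP => A /block_nonempty[i _]; exists [set: 'I_n] => //.
by rewrite !inE eqxx andbT; apply/set0Pn; exists i.
Qed.

HB.instance Definition _ :=
  @Order.hasBottom.Build refinement_display setpart singletons singletons_bottom.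
HB.instance Definition _ :=
  @Order.hasTop.Build refinement_display setpart one_block one_block_top.

(* sub_ord k has value n - k. *)
Definition rank P : 'I_n.+1 := sub_ord #|P|.

Fact permute_partition P (s : 'S_n) :
  partition [set s @: A | A : {set 'I_n} in P] [set: 'I_n].
Proof.
apply/and3P; split.
- apply/eqP/setP => i; rewrite inE; apply/bigcupP.
  have [A AP iA] := block_exists P (s^-1%g i).
  exists (s @: A); first exact: imset_f.
  by apply/imsetP; exists (s^-1%g i); rewrite ?permKV.
- apply/trivIsetP => _ _ /imsetP[A AP ->] /imsetP[B BP ->] AB.
  apply/pred0P => i /=; apply/negP => /andP[/imsetP[j jA ->]].
  rewrite (mem_imset _ _ perm_inj) => jB.
  by rewrite (block_unique AP BP jA jB) eqxx in AB.
- apply/imsetP => -[A /block_nonempty[i iA]] /setP/(_ (s i)).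
  by rewrite inE imset_f.
Qed.

Definition permute P (s : 'S_n) : setpart := SetPart (permute_partition P s).

Fact permute1 P : permute P 1%g = P.
Proof.
apply/val_inj => /=; rewrite -[RHS]imset_id; apply: eq_imset => A /=.
by rewrite -[RHS]imset_id; apply: eq_imset => i; rewrite perm1.
Qed.

Fact permuteM P (s t : 'S_n) : permute P (s * t)%g = permute (permute P s) t.
Proof.
apply/val_inj => /=; rewrite -imset_comp; apply: eq_imset => A /=.
by rewrite -imset_comp; apply: eq_imset => i; rewrite /= permM.
Qed.

Definition setpart_action : {action 'S_n &-> setpart} :=
  TotalAction permute1 permuteM.

Definition chain_action : {action 'S_n &-> {set setpart}} := setpart_action^*.

Definition is_chain (C : {set setpart}) :=
  [forall P in C, (\bot < P < \top)%O] &&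
  [forall P in C, forall Q in C, (P >=< Q)%O].

Definition chains (T : {set 'I_n.+1}) : {set {set setpart}} :=
  [set C | is_chain C & [set rank P | P in C] == T].

Lemma le_permute (s : 'S_n) : {mono permute^~ s : P Q / (P <= Q)%O}.
Proof.
have h P Q t : (P <= Q)%O -> (permute P t <= permute Q t)%O.
  move=> /refinesP PQ; apply/refinesP => _ /imsetP[A AP ->].
  have [B BQ AB] := PQ A AP.
  by exists (t @: B); [exact: imset_f | exact: imsetS].
move=> P Q; apply/idP/idP; last exact: h.
by move=> /(h _ _ s^-1%g); rewrite -!permuteM mulgV !permute1.
Qed.

Lemma lt_permute (s : 'S_n) : {mono permute^~ s : P Q / (P < Q)%O}.
Proof. exact: leW_mono (le_permute s). Qed.

Lemma permute_bot (s : 'S_n) : permute \bot%O s = \bot%O.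
Proof.
apply: le_anti; rewrite le0x andbT -(le_permute s^-1%g) -permuteM mulgV permute1.
exact: le0x.
Qed.

Lemma permute_top (s : 'S_n) : permute \top%O s = \top%O.
Proof.
apply: le_anti; rewrite lex1 /= -(le_permute s^-1%g) -permuteM mulgV permute1.
exact: lex1.
Qed.

Lemma rank_permute (s : 'S_n) P : rank (permute P s) = rank P.
Proof.
by apply/val_inj; rewrite /= card_imset //; exact/imset_inj/perm_inj.
Qed.

Lemma chains_acts T : [acts [set: 'S_n], on chains T | chain_action].
Proof.
apply/subsetP => s _; rewrite !inE /=; apply/subsetP => C.
rewrite !inE /= => /andP[/andP[/forall_inP h1 /forall_inP h2] /eqP h3].
apply/andP; split; last first.
  rewrite -h3 -imset_comp; apply/eqP/eq_imset => P /=; exact: rank_permute.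
apply/andP; split; apply/forall_inP => _ /imsetP[P PC ->] /=.
  rewrite -[X in (X < _)%O](permute_bot s) -[X in _ && (_ < X)%O](permute_top s).
  by rewrite !lt_permute h1.
apply/forall_inP => _ /imsetP[Q QC ->] /=.
by rewrite /Order.comparable !le_permute; exact: (forall_inP (h2 P PC)).
Qed.

End SetPartitions.

Section PermutationRepresentation.

Variables (gT : finGroupType) (X : finType) (to : {action gT &-> X}).
Variables (G : {group gT}) (A : {set X}).

Definition perm_repr_mx (x : gT) : 'M[algC]_#|A| :=
  \matrix_(i, j) (to (enum_val i) x == enum_val j)%:R.

Hypothesis actsGA : [acts G, on A | to].

Fact perm_repr_mx_repr : mx_repr G perm_repr_mx.
Proof.
split=> [|x y Gx Gy]; apply/matrixP => i j; rewrite !mxE.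
  by rewrite act1 (inj_eq enum_val_inj).
have ixA : to (enum_val i) x \in A by rewrite (acts_act actsGA) ?enum_valP.
rewrite (bigD1 (enum_rank_in ixA (to (enum_val i) x))) //= !mxE.
rewrite enum_rankK_in // eqxx mul1r -actM big1 ?addr0 // => k.
move=> kx; rewrite !mxE; case: eqP => [e|_]; last by rewrite mul0r.
by case/eqP: kx; apply: enum_val_inj; rewrite enum_rankK_in.
Qed.

Definition perm_repr : mx_representation algC G #|A| :=
  MxRepresentation perm_repr_mx_repr.

End PermutationRepresentation.

Definition alpha n (T : {set 'I_n.+1}) : 'CF([set: 'S_n]) :=
  cfRepr (perm_repr (@chains_acts n T)).

Definition beta n (S : {set 'I_n.+1}) : 'CF([set: 'S_n]) :=
  \sum_(T : {set 'I_n.+1} | T \subset S) (-1) ^+ #|S :\: T| *: alpha T.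

(* S_(n-1) x S_1: the permutations supported on the first n - 1 points. *)
Definition young n : {group 'S_n} :=
  [group of perm.Sym [set i : 'I_n | (i < n.-1)%N]].

(* Multiplicities are inner products of characters; 1 is the trivial one. *)
Definition b' n (S : {set 'I_n.+1}) : algC := '['Res[young n] (beta S), 1].

(* Main.v *)
(* A cycle is a function on the chains with rank set S whose sum over the
   fillings of every one-element gap is zero.  Averaging over the Young
   subgroup, b'_S(n) is the dimension of the invariant cycles, as soon as the
   gap sums map cycles onto cycles.  The latter is the Cohen-Macaulay property
   of the partition lattice: when a merge is labelled by the larger of the two
   block minima, every interval has one increasing chain, and restricting each
   chain to its descents makes the gap conditions triangular, so that one can
   solve for the cycle.

   Lower bound: the points may be reordered, above any given partition, so that
   the block of n carries the last labels.  A step enlarging this block is then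
   always a descent, and it follows that any function on the chains along which
   the block of n grows at every step extends to a cycle.  There are always such
   chains, and they form at least two orbits unless S = {1, ..., i}.

   Upper bound, for S = {1, ..., i}: an invariant cycle that vanishes on the
   chain whose only nontrivial blocks are {n-r, ..., n} is zero.  A chain leaves
   this pattern by merging pairs of unmarked singletons; the gap condition at
   the last of these pairs involves only chains with fewer of them and chains
   conjugate to the given one. *)
From HB Require Import structures.
Require Import Defs.
From mathcomp Require Import all_boot all_order all_algebra all_fingroup.
From mathcomp Require Import all_field all_character.
From mathcomp Require Import zify.
Import Order.TTheory GRing.Theory Num.Theory.
Local Open Scope ring_scope.

Set Implicit Arguments.
Unset Strict Implicit.
Unset Printing Implicit Defensive.

(** * Set partitions as equivalence relations *)

Section Blocks.

Variable n : nat.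
Implicit Types (x y z : setpart n) (u v t : 'I_n).

Definition same x u v := v \in pblock x u.

Lemma sameP x u v : reflect (exists2 A, A \in blocks x & (u \in A) /\ (v \in A)) (same x u v).
Proof.
have /and3P[/eqP cP tP _] := valP x.
apply: (iffP idP) => [h|[A Ax [uA vA]]].
  exists (pblock x u) => //; first by rewrite pblock_mem // cP inE.
  by rewrite mem_pblock cP inE.
by rewrite /same (def_pblock tP Ax uA).
Qed.

Lemma same_refl x u : same x u u.
Proof. by have [A Ax uA] := block_exists x u; apply/sameP; exists A. Qed.

Lemma same_sym x u v : same x u v = same x v u.
Proof. by apply/sameP/sameP => -[A Ax [? ?]]; exists A. Qed.

Lemma same_trans x v u t : same x u v -> same x v t -> same x u t.
Proof.
move=> /sameP[A Ax [uA vA]] /sameP[B Bx [vB tB]].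
by apply/sameP; exists A => //; rewrite {2}(block_unique Ax Bx vA vB).
Qed.

Lemma same_transl x u v t : same x u v -> same x u t = same x v t.
Proof.
move=> uv; apply/idP/idP; first by apply: same_trans; rewrite same_sym.
exact: same_trans.
Qed.

Lemma le_sameP x y :
  reflect (forall u v, same x u v -> same y u v) (x <= y)%O.
Proof.
apply: (iffP (refinesP x y)) => [h u v /sameP[A /h[B By AB] [uA vA]]|h A Ax].
  by apply/sameP; exists B => //; rewrite !(subsetP AB).
have [u uA] := block_nonempty Ax; have [B By uB] := block_exists y u.
exists B => //; apply/subsetP => v vA.
have /sameP[B' By' [uB' vB']] : same y u v by apply/h/sameP; exists A.
by rewrite (block_unique By By' uB uB').
Qed.

Lemma le_same x y u v : (x <= y)%O -> same x u v -> same y u v.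
Proof. by move/le_sameP; apply. Qed.

Lemma eq_same x y : (forall u v, same x u v = same y u v) -> x = y.
Proof.
by move=> h; apply: le_anti; apply/andP; split; apply/le_sameP => u v; rewrite h.
Qed.

Lemma same_permute x (s : 'S_n) u v : same (permute x s) (s u) (s v) = same x u v.
Proof.
apply/sameP/sameP => [[_ /imsetP[A Ax ->]] |[A Ax [uA vA]]].
  by rewrite !(mem_imset _ _ perm_inj) => h; exists A.
by exists (s @: A); rewrite ?imset_f ?(mem_imset _ _ perm_inj).
Qed.

Lemma same_bot u v : same (\bot%O : setpart n) u v = (u == v).
Proof.
apply/sameP/eqP => [[_ /imsetP[w _ ->]]|->].
  by rewrite !inE => -[/eqP-> /eqP->].
by exists [set v]; rewrite ?imset_f ?set11.
Qed.

Lemma same_top u v : same (\top%O : setpart n) u v.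
Proof.
apply/sameP; exists [set: 'I_n]; last by rewrite !inE.
by rewrite !inE eqxx andbT; apply/set0Pn; exists u.
Qed.

Definition kernel_part (T : eqType) (f : 'I_n -> T) : setpart n :=
  SetPart (preim_partitionP f [set: 'I_n]).

Lemma same_kernel (T : eqType) (f : 'I_n -> T) u v :
  same (kernel_part f) u v = (f u == f v).
Proof.
rewrite /same pblock_equivalence_partition ?inE //.
by move=> ? ? ? _ _ _ /=; split=> // /eqP ->.
Qed.

End Blocks.

(** * Labels of merges, and increasing elements of intervals *)

Section Labels.

Variables (n : nat) (g : 'I_n -> nat).
Hypothesis g_inj : injective g.
Implicit Types (x y z : setpart n) (u v t : 'I_n).

Definition block_min x u := [arg min_(v < u | same x u v) g v].

Lemma block_min_same x u : same x u (block_min x u).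
Proof. by rewrite /block_min; case: arg_minnP; rewrite ?same_refl. Qed.

Lemma block_min_le x u v : same x u v -> (g (block_min x u) <= g v)%N.
Proof. by rewrite /block_min; case: arg_minnP; rewrite ?same_refl // => i _ h /h. Qed.

Lemma block_minP x u v :
  same x u v -> (forall t, same x u t -> (g v <= g t)%N) -> block_min x u = v.
Proof.
move=> uv h; apply/g_inj/eqP.
by rewrite eqn_leq block_min_le // h ?block_min_same.
Qed.

Lemma eq_block_min x u v : same x u v -> block_min x u = block_min x v.
Proof.
move=> uv; apply: block_minP; first by rewrite (same_trans uv) ?block_min_same.
by move=> t ut; apply: block_min_le; rewrite -(same_transl _ uv).
Qed.

Lemma block_minK x u : block_min x (block_min x u) = block_min x u.
Proof. by apply/esym/eq_block_min/block_min_same. Qed.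

Lemma same_block_min x u v : same x u v = (block_min x u == block_min x v).
Proof.
apply/idP/eqP => [/eq_block_min //|e].
by apply: same_trans (block_min_same x u) _; rewrite e same_sym block_min_same.
Qed.

(** Merging two blocks adds one point to this set, the larger of their minima, which is the label of
    the merge. Hence for [x <= y] the set [nonmin y :\: nonmin x] consists of the labels of any
    maximal chain from [x] to [y]. *)
Definition nonmin x := [set u | block_min x u != u].

Lemma nonminP x u :
  reflect (exists2 v, same x u v & (g v < g u)%N) (u \in nonmin x).
Proof.
rewrite inE; apply: (iffP idP) => [h|[v uv lt]].
  exists (block_min x u); first exact: block_min_same.
  by rewrite ltn_neqAle (inj_eq g_inj) h block_min_le ?same_refl.
by apply: contraTneq lt => <-; rewrite -leqNgt block_min_le.
Qed.

Lemma block_min_nonmin x u : block_min x u \notin nonmin x.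
Proof. by rewrite inE block_minK eqxx. Qed.

Lemma block_min_id x u : u \notin nonmin x -> block_min x u = u.
Proof. by rewrite inE negbK => /eqP. Qed.

Lemma card_blocks x : (#|nonmin x| + #|blocks x| = n)%N.
Proof.
have <- : #|~: nonmin x| = #|blocks x|; last first.
  by rewrite cardsC card_ord.
have inj : {in ~: nonmin x &, injective (pblock x)}.
  move=> u v; rewrite !inE !negbK => /eqP eu /eqP ev e.
  by rewrite -eu -ev; apply: eq_block_min; rewrite /same e; exact: same_refl.
rewrite -(card_in_imset inj); apply: eq_card => A; apply/imsetP/idP => [[u _ ->]|Ax].
  have /and3P[/eqP cP _ _] := valP x.
  by rewrite pblock_mem // cP inE.
have [u uA] := block_nonempty Ax.
exists (block_min x u); first by rewrite inE block_min_nonmin.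
have /and3P[_ tP _] := valP x.
have /sameP[B Bx [uB mB]] := block_min_same x u.
by rewrite (block_unique Ax Bx uA uB) (def_pblock tP Bx mB).
Qed.

Lemma rankE x : rank x = #|nonmin x| :> nat.
Proof. by rewrite -[RHS](addnK #|blocks x|) card_blocks. Qed.

Lemma nonmin_le x y : (x <= y)%O -> nonmin x \subset nonmin y.
Proof.
move=> xy; apply/subsetP => u /nonminP[v uv lt].
by apply/nonminP; exists v => //; apply: le_same uv.
Qed.

(** With equal sets, every block minimum of [x] would still be one of [y], so the blocks would
    agree. *)
Lemma nonmin_lt x y : (x < y)%O -> nonmin x \proper nonmin y.
Proof.
move=> xy; rewrite properEneq nonmin_le ?ltW // andbT.
apply: contraTneq xy => e; apply/negP; rewrite lt_neqAle => /andP[/eqP ne xy]; apply: ne.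
have bE w : block_min y w = block_min x w.
  rewrite (eq_block_min (le_same xy (block_min_same x w))).
  by rewrite block_min_id // -e block_min_nonmin.
by apply: eq_same => u v; rewrite !same_block_min !bE.
Qed.

(** For [x <= z <= y] this says that [z] lies on the increasing maximal chain of the interval: every
    label used below [z] is smaller than every label used above it. *)
Definition incr x z y :=
  [forall u in nonmin z :\: nonmin x, forall v in nonmin y :\: nonmin z,
    (g u < g v)%N].

Lemma incrP x z y :
  reflect (forall u v, u \in nonmin z -> u \notin nonmin x ->
             v \in nonmin y -> v \notin nonmin z -> (g u < g v)%N)
          (incr x z y).
Proof.
apply: (iffP forall_inP) => [h u v uz ux vy vz|h u].
  by apply: (forall_inP (h u _)); rewrite inE ?uz ?ux ?vy ?vz.
by rewrite inE => /andP[ux uz]; apply/forall_inP => v; rewrite inE => /andP[vz vy]; apply: h.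
Qed.

Lemma incr_sub x z y x' y' :
  incr x z y -> (x <= x')%O -> (y' <= y)%O -> incr x' z y'.
Proof.
move=> /incrP h /nonmin_le/subsetP xx' /nonmin_le/subsetP yy'; apply/incrP => u v uz ux vy vz.
by apply: h => //; [apply: contra ux; apply: xx' | apply: yy'].
Qed.

(** A label [w] used between [z1] and [z2] separates the labels below [z1] from those above [z2]. *)
Lemma incr_trans x z1 z2 y : (x < z1)%O -> (z1 < z2)%O -> (z2 < y)%O ->
  incr x z1 z2 -> incr z1 z2 y -> incr x z1 y /\ incr x z2 y.
Proof.
move=> xz1 z12 z2y /incrP h1 /incrP h2.
have /properP[s12 [w wz2 wz1]] := nonmin_lt z12.
split; apply/incrP => u v.
  move=> uz ux vy vz; have uw := h1 _ _ uz ux wz2 wz1.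
  have [vz2|vz2] := boolP (v \in nonmin z2); first exact: h1.
  by apply: ltn_trans uw _; apply: h2.
move=> uz ux vy vz; have wv := h2 _ _ wz2 wz1 vy vz.
have [uz1|uz1] := boolP (u \in nonmin z1); last exact: h2.
by apply: ltn_trans (h1 _ _ uz1 ux wz2 wz1) wv.
Qed.

(* An increasing element of an interval is determined by its non-minimal points:
   each of the new ones is merged with the minimum of its block in [y]. *)
Lemma incr_block_min x z y u : (x <= z)%O -> (z <= y)%O -> incr x z y ->
  block_min z u =
    if block_min x u \in nonmin z then block_min y u else block_min x u.
Proof.
move=> xz zy /incrP h; set v := block_min x u.
have uv : same z u v by apply: le_same xz (block_min_same x u).
rewrite (eq_block_min uv) (eq_block_min (le_same zy uv)).
case: ifPn => [vz|/block_min_id //].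
have vm := block_min_same z v.
rewrite (eq_block_min (le_same zy vm)).
have [my|/block_min_id->//] := boolP (block_min z v \in nonmin y).
have := h v (block_min z v) vz (block_min_nonmin x u) my (block_min_nonmin z v).
by rewrite ltnNge block_min_le // same_refl.
Qed.

(** The condition sees [z] only through [nonmin z], so [z'] is increasing too, and [incr_block_min]
    computes both from the same data. *)
Lemma incr_uniq x z z' y : (x <= z)%O -> (z <= y)%O -> (x <= z')%O -> (z' <= y)%O ->
  incr x z y -> nonmin z = nonmin z' -> z = z'.
Proof.
move=> xz zy xz' zy' h e.
have h' : incr x z' y by apply/incrP; rewrite -e; apply/incrP.
apply: eq_same => u v; rewrite !same_block_min.
by rewrite !(incr_block_min _ xz zy h) !(incr_block_min _ xz' zy' h') e.
Qed.

(** The quantity that makes the gap conditions triangular: by [incr_weight], the increasing element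
    is the lightest one of its rank in the interval. *)
Definition weight z := (\sum_(u in nonmin z) g u)%N.

(** The common part of [A] and [B] cancels. What remains are two nonempty sets of equal size, every
    label in [A :\: B] being below every label in [B :\: A]. *)
Lemma sum_lt_initial (D A B : {set 'I_n}) : A \subset D -> B \subset D ->
  #|A| = #|B| -> A != B ->
  (forall u v, u \in A -> v \in D -> v \notin A -> (g u < g v)%N) ->
  (\sum_(u in A) g u < \sum_(u in B) g u)%N.
Proof.
move=> AD BD cAB neq h.
rewrite [X in (X < _)%N](big_setID B) [X in (_ < X)%N](big_setID A) /= setIC ltn_add2l.
have cD : #|A :\: B| = #|B :\: A|.
  by apply/eqP; rewrite -(eqn_add2l #|A :&: B|) cardsID setIC cardsID cAB.
have : A :\: B != set0.
  apply: contraNneq neq => /eqP; rewrite setD_eq0 => AB.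
  by rewrite eqEcard AB cAB leqnn.
case/set0Pn => a0 a0D.
(* The largest label of [A :\: B] bounds one sum from above and, increased by one, the other from
   below. *)
pose a := [arg max_(u > a0 in A :\: B) g u].
have [aD amax] : a \in A :\: B /\ forall u, u \in A :\: B -> (g u <= g a)%N.
  by rewrite /a; case: arg_maxnP.
apply: (@leq_ltn_trans (\sum_(u in A :\: B) g a)); first by apply: leq_sum => u; apply: amax.
apply: (@leq_trans (\sum_(u in B :\: A) (g a).+1)).
  rewrite !sum_nat_const -cD ltn_pmul2l //; apply/card_gt0P; by exists a0.
apply: leq_sum => v; rewrite inE => /andP[vA vB].
by move: aD; rewrite inE => /andP[_ aA]; apply: h => //; apply: (subsetP BD).
Qed.

(** The labels of [z] above [x] form an initial segment of the labels of the interval, those of [z']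
    a different set of the same size. *)
Lemma incr_weight x z z' y : (x <= z)%O -> (z <= y)%O -> (x <= z')%O -> (z' <= y)%O ->
  incr x z y -> rank z' = rank z -> z' != z -> (weight z < weight z')%N.
Proof.
move=> xz zy xz' zy' h rzz neq.
have ne : nonmin z != nonmin z'.
  by apply: contraNneq neq => /(incr_uniq xz zy xz' zy' h) ->.
rewrite /weight (big_setID (nonmin x)) [X in (_ < X)%N](big_setID (nonmin x)) /=.
rewrite !(setIidPr (nonmin_le _)) // ltn_add2l.
apply: (@sum_lt_initial (nonmin y :\: nonmin x)); rewrite ?setSD ?nonmin_le //.
- by rewrite !cardsD !(setIidPr (nonmin_le _)) // -!rankE rzz.
- apply: contraNneq ne => e.
  rewrite -(setID (nonmin z) (nonmin x)) e -[X in _ == X](setID _ (nonmin x)).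
  by rewrite !(setIidPr (nonmin_le _)).
move=> u v; rewrite !in_setD => /andP[ux uz] /andP[vx vy]; rewrite vx andTb => vz.
by move/incrP: h; apply.
Qed.

Lemma initial_subset (D : {set 'I_n}) k : (k <= #|D|)%N ->
  exists A : {set 'I_n}, [/\ A \subset D, #|A| = k &
    forall u v, u \in A -> v \in D -> v \notin A -> (g u < g v)%N].
Proof.
elim: k => [|k IH] kD; first by exists set0; rewrite sub0set cards0; split=> // u v; rewrite inE.
have [A [AD cA hA]] := IH (ltnW kD).
have [a0 a0D a0A] : exists2 a, a \in D & a \notin A.
  apply/subsetPn; apply/negP => /subset_leq_card; rewrite cA; lia.
pose a := [arg min_(u < a0 in D :\: A) g u].
have [aD amin] : a \in D :\: A /\ forall u, u \in D :\: A -> (g a <= g u)%N.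
  by rewrite /a; case: arg_minnP; rewrite ?inE ?a0A.
move: aD; rewrite inE => /andP[aA aD].
exists (a |: A); split; first by rewrite subUset sub1set aD AD.
  by rewrite cardsU1 aA cA.
move=> u v; rewrite !inE negb_or => /orP[/eqP->|uA] vD /andP[va vA]; last exact: hA.
by rewrite ltn_neqAle (inj_eq g_inj) eq_sym va amin // inE vA.
Qed.

(** The new non-minimal points are the [r - rank x] smallest labels of the interval. *)
Lemma incr_exists x y r : (x < y)%O -> (rank x < r)%N -> (r < rank y)%N ->
  exists z, [/\ (x < z)%O, (z < y)%O, rank z = r :> nat & incr x z y].
Proof.
move=> xy rx ry; have xy' := ltW xy.
have cD : #|nonmin y :\: nonmin x| = (rank y - rank x)%N.
  by rewrite cardsD (setIidPr (nonmin_le xy')) -!rankE.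
have [|A [AD cA hA]] := @initial_subset (nonmin y :\: nonmin x) (r - rank x).
  rewrite cD; lia.
(* [f] is the intended [block_min z]: a block of [x] whose minimum lies in [A] joins the block of
   [x] that contains the minimum of its block in [y]. *)
pose f u := if block_min x u \in A then block_min y u else block_min x u.
have fy u : same y u (f u).
  by rewrite /f; case: ifP => _; rewrite ?block_min_same // (le_same xy') // block_min_same.
have Ay u : u \in A -> u \in nonmin y by move/(subsetP AD); rewrite inE => /andP[].
have Ax u : u \in A -> u \notin nonmin x by move/(subsetP AD); rewrite inE => /andP[].
have fK u : f (f u) = f u.
  rewrite {2}/f; case: ifPn => h; rewrite /f.
    have nx : block_min y u \notin nonmin x.
      by apply: contra (block_min_nonmin y u); apply: (subsetP (nonmin_le xy')).
    by rewrite block_min_id // h ifN // (contra (@Ay _)) // block_min_nonmin.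
  by rewrite block_minK (negPf h).
have fle u : (g (f u) <= g u)%N.
  by rewrite /f; case: ifP => _; rewrite block_min_le // same_refl.
pose z := kernel_part f.
have zE u v : same z u v = (f u == f v) by exact: same_kernel.
have bz u : block_min z u = f u.
  apply: block_minP; first by rewrite zE fK.
  by move=> t; rewrite zE => /eqP->.
have nz : nonmin z = nonmin x :|: A.
  apply/setP => u; rewrite [in LHS]inE bz in_setU.
  have [uA|uA] := boolP (u \in A).
    rewrite orbT /f block_min_id ?Ax // uA; apply: contraTneq (Ay _ uA) => <-.
    exact: block_min_nonmin.
  rewrite orbF [in RHS]inE /f; case: ifPn => h //.
  have -> : block_min x u != u by apply: contraNneq uA => <-.
  apply/eqP => e; case/negP: uA; rewrite -[u](@block_min_id x) //.
  by apply: contra (block_min_nonmin y u); rewrite e; apply/subsetP/nonmin_le.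
have xz : (x <= z)%O.
  apply/le_sameP => u v uv; rewrite zE /f (eq_block_min uv).
  by rewrite (eq_block_min (le_same xy' uv)).
have zy : (z <= y)%O.
  apply/le_sameP => u v; rewrite zE => /eqP e.
  by apply: same_trans (fy u) _; rewrite e same_sym fy.
have rz : rank z = r :> nat.
  rewrite rankE nz cardsU cA -rankE.
  have -> : nonmin x :&: A = set0.
    by apply/setP => u; rewrite in_setI in_set0; apply/negbTE/negP => /andP[ux /Ax]; rewrite ux.
  by rewrite cards0 subn0; lia.
exists z; split=> //.
- by rewrite lt_neqAle xz andbT; apply: contraTneq rx => ->; rewrite rz ltnn.
- by rewrite lt_neqAle zy andbT; apply: contraTneq ry => <-; rewrite rz ltnn.
apply/incrP => u v; rewrite nz !in_setU => /orP[-> //|uA] _ vy.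
by rewrite negb_or => /andP[vx vA]; apply: hA; rewrite // inE vx vy.
Qed.

End Labels.

(** * Chains and their descents *)

Section Chains.

Variable n : nat.
Implicit Types (x y z a b : setpart n) (C B Q : {set setpart n}) (S R : {set 'I_n.+1}).

Lemma rank_lt x y : (x < y)%O -> (rank x < rank y)%N.
Proof.
have i : injective (@nat_of_ord n) := val_inj.
by move=> xy; rewrite !(rankE i) proper_card // nonmin_lt.
Qed.

Lemma rank_le x y : (x <= y)%O -> (rank x <= rank y)%N.
Proof. by rewrite le_eqVlt => /orP[/eqP->//|/rank_lt/ltnW]. Qed.

Lemma comparable_lt_rank x y : (x >=< y)%O -> (x < y)%O = (rank x < rank y)%N.
Proof.
by case/comparable_ltP => [/rank_lt ->//|/rank_le]; rewrite leqNgt => /negbTE->.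
Qed.

Definition chains_above x S :=
  [set C in chains S | [forall z in C, (x < z)%O]].

Lemma chains_aboveP x S C :
  reflect [/\ forall z, z \in C -> (x < z)%O /\ (z < \top)%O,
              forall z z', z \in C -> z' \in C -> (z >=< z')%O &
              [set rank z | z in C] = S]
          (C \in chains_above x S).
Proof.
rewrite !inE -andbA; apply: (iffP and3P).
  move=> [/andP[/forall_inP h1 /forall_inP h2] /eqP h3 /forall_inP h4].
  split=> // [z zC|z z' zC]; first by case/andP: (h1 z zC) => _ ->; rewrite h4.
  by apply: forall_inP; apply: h2.
move=> [h1 h2 ->]; split=> //; last by apply/forall_inP => z /h1[].
apply/andP; split; apply/forall_inP => z zC.
  by have [xz ->] := h1 z zC; rewrite andbT (le_lt_trans (le0x x)).
by apply/forall_inP => z'; apply: h2.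
Qed.

Lemma chains_above_bot S : chains_above \bot%O S = chains S.
Proof.
apply/setP => C; rewrite inE andb_idr // => CS; apply/forall_inP => z zC.
by move: CS; rewrite !inE => /andP[/andP[/forall_inP/(_ z zC)/andP[]]].
Qed.

Definition select C R := [set z in C | rank z \in R].

Section Above.

Variable x : setpart n.

Lemma chain_lt S C z z' : C \in chains_above x S -> z \in C -> z' \in C ->
  (z < z')%O = (rank z < rank z')%N.
Proof. by case/chains_aboveP => _ h _ zC z'C; apply/comparable_lt_rank/h. Qed.

Lemma chain_rank_inj S C z z' : C \in chains_above x S -> z \in C -> z' \in C ->
  rank z = rank z' -> z = z'.
Proof.
move=> CS zC z'C e; have /chains_aboveP[_ /(_ z z' zC z'C) h _] := CS.
by have := chain_lt CS zC z'C; have := chain_lt CS z'C zC; rewrite e ltnn;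
  case: comparableP h.
Qed.

Lemma chain_rank S C z : C \in chains_above x S -> z \in C -> rank z \in S.
Proof. by case/chains_aboveP => _ _ <- zC; rewrite imset_f. Qed.

Lemma chain_elt S C (r : 'I_n.+1) : C \in chains_above x S -> r \in S ->
  exists2 z, z \in C & rank z = r.
Proof. by case/chains_aboveP => _ _ <- /imsetP[z zC ->]; exists z. Qed.

Lemma chain_sub_eq S C B : C \in chains_above x S -> B \in chains_above x S ->
  C \subset B -> C = B.
Proof.
move=> CS BS CB; apply/eqP; rewrite eqEsubset CB; apply/subsetP => z zB.
have [z' z'C e] := chain_elt CS (chain_rank BS zB).
by rewrite -(chain_rank_inj BS (subsetP CB _ z'C) zB e).
Qed.

Lemma select_chain S C R : C \in chains_above x S -> R \subset S ->
  select C R \in chains_above x R.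
Proof.
move=> CS RS; have /chains_aboveP[h1 h2 h3] := CS; apply/chains_aboveP; split.
- by move=> z; rewrite inE => /andP[/h1].
- by move=> z z'; rewrite !inE => /andP[zC _] /andP[z'C _]; apply: h2.
apply/setP => r; apply/imsetP/idP => [[z]|rR]; first by rewrite inE => /andP[_ ?] ->.
have [z zC e] := chain_elt CS (subsetP RS _ rR).
by exists z; rewrite // inE zC e.
Qed.

Lemma select_subset C R : select C R \subset C.
Proof. by apply/subsetP => z; rewrite inE => /andP[]. Qed.

Lemma subset_select C R Q : (forall z, z \in Q -> rank z \in R) ->
  (Q \subset select C R) = (Q \subset C).
Proof.
move=> h; apply/idP/idP => [|/subsetP QC].
  by move/subset_trans; apply; apply: select_subset.
by apply/subsetP => z zQ; rewrite inE QC ?h.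
Qed.

Lemma select_eq S C R B : C \in chains_above x S -> B \in chains_above x R ->
  R \subset S -> (select C R == B) = (B \subset C).
Proof.
move=> CS BR RS; apply/eqP/idP => [<-|BC]; first exact: select_subset.
apply/esym/(chain_sub_eq BR (select_chain CS RS)).
by rewrite subset_select // => z /(chain_rank BR).
Qed.

Lemma ext_comparable S C z z' : C \in chains_above x S ->
  z \in x |: (\top%O |: C) -> z' \in x |: (\top%O |: C) -> (z >=< z')%O.
Proof.
case/chains_aboveP=> h1 h2 _; rewrite !in_setU !in_set1.
have hx w : [|| w == x, w == \top%O | w \in C] -> (x <= w)%O.
  by case/or3P=> [/eqP->|/eqP->|/h1[/ltW]] //; apply: lex1.
move=> zC z'C; case/or3P: (zC) => [/eqP->|/eqP->|zC'].
- exact/le_comparable/hx.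
- exact/ge_comparable/lex1.
case/or3P: z'C => [/eqP->|/eqP->|z'C']; last exact: h2.
- exact/ge_comparable/hx.
- exact/le_comparable/lex1.
Qed.

Lemma ext_lt S C z z' : C \in chains_above x S ->
  z \in x |: (\top%O |: C) -> z' \in x |: (\top%O |: C) ->
  (z < z')%O = (rank z < rank z')%N.
Proof. by move=> CS zC z'C; apply/comparable_lt_rank/(ext_comparable CS). Qed.

Lemma ext_le S C z z' : C \in chains_above x S ->
  z \in x |: (\top%O |: C) -> z' \in x |: (\top%O |: C) ->
  (rank z <= rank z')%N -> (z <= z')%O.
Proof.
move=> CS zC z'C; rewrite leqNgt -(ext_lt CS z'C zC).
by rewrite comparable_leNgt //; apply: ext_comparable CS zC z'C.
Qed.

Lemma chain_pred C r : (rank x < r)%N -> exists2 a, a \in x |: C &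
  (rank a < r)%N /\ forall u, u \in x |: C -> (rank u < r)%N -> (rank u <= rank a)%N.
Proof.
move=> xr; pose A := [set u in x |: C | (rank u < r)%N].
have xA : x \in A by rewrite inE setU11.
exists [arg max_(a > x in A) rank a]; case: arg_maxnP => // a; rewrite inE => /andP[] //.
by move=> aC ar h; split=> // u uC ur; apply: h; rewrite inE uC.
Qed.

Lemma chain_succ C r : (r < rank (\top%O : setpart n))%N -> exists2 b, b \in \top%O |: C &
  (r < rank b)%N /\ forall u, u \in \top%O |: C -> (r < rank u)%N -> (rank b <= rank u)%N.
Proof.
move=> xr; pose A := [set u in \top%O |: C | (r < rank u)%N].
have xA : \top%O \in A by rewrite inE setU11.
exists [arg min_(a < \top%O in A) rank a]; case: arg_minnP => // a; rewrite inE => /andP[] //.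
by move=> aC ar h; split=> // u uC ur; apply: h; rewrite inE uC.
Qed.

Variable g : 'I_n -> nat.
Hypothesis g_inj : injective g.

(** Any [a] and [b] of the extended chain are allowed: by [incr_sub] the condition passes to smaller
    intervals, so it comes down to the two neighbours of [z]. *)
Definition ascent C z :=
  [exists a in x |: C, exists b in \top%O |: C,
    [&& (a < z)%O, (z < b)%O & incr g a z b]].

Lemma ascentP C z : reflect
  (exists a b, [/\ a \in x |: C, b \in \top%O |: C, (a < z)%O, (z < b)%O & incr g a z b])
  (ascent C z).
Proof.
apply: (iffP exists_inP) => [[a aC /exists_inP[b bC /and3P[? ? ?]]]|[a [b [aC bC ? ? ?]]]].
  by exists a, b.
by exists a => //; apply/exists_inP; exists b => //; apply/and3P.
Qed.

Definition descents C := [set z in C | ~~ ascent C z].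

Lemma descents_sub C : descents C \subset C.
Proof. by apply/subsetP => z; rewrite inE => /andP[]. Qed.

Lemma mem_ascent C v z : z \in v |: C -> z \notin v |: descents C ->
  z \in C /\ ascent C z.
Proof.
rewrite !in_setU1 negb_or inE => h /andP[/negbTE zv].
by move: h; rewrite zv /= => ->; rewrite negbK.
Qed.

Let extU C a : a \in x |: C -> a \in x |: (\top%O |: C).
Proof. by rewrite !in_setU => /orP[->|->]; rewrite ?orbT. Qed.

Let extT C a : a \in \top%O |: C -> a \in x |: (\top%O |: C).
Proof. by rewrite !in_setU => ->; rewrite orbT. Qed.

Let extC C a : a \in C -> a \in x |: (\top%O |: C).
Proof. by rewrite !in_setU => ->; rewrite !orbT. Qed.

Lemma ascent_neighbours S C z a b : C \in chains_above x S -> z \in C -> ascent C z ->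
  a \in x |: C -> (forall u, u \in x |: C -> (rank u < rank z)%N -> (rank u <= rank a)%N) ->
  b \in \top%O |: C ->
  (forall u, u \in \top%O |: C -> (rank z < rank u)%N -> (rank b <= rank u)%N) ->
  incr g a z b.
Proof.
move=> CS zC /ascentP[a' [b' [aC' bC' az zb h]]] aC ha bC hb.
apply: (incr_sub g_inj h).
  by apply: (ext_le CS (extU aC') (extU aC)); apply: ha => //; apply: rank_lt.
by apply: (ext_le CS (extT bC) (extT bC')); apply: hb => //; apply: rank_lt.
Qed.

(** If the upper neighbour of [z] is a descent or the top, it serves as [b]. Otherwise it is an
    ascent with lower neighbour [z]; induction gives a bound above it, and [incr_trans] joins the
    two conditions. *)
Lemma ascent_up S C z a : C \in chains_above x S -> z \in C -> ascent C z ->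
  a \in x |: C -> (rank a < rank z)%N ->
  (forall u, u \in x |: C -> (rank u < rank z)%N -> (rank u <= rank a)%N) ->
  exists2 b, b \in \top%O |: descents C & (z < b)%O /\ incr g a z b.
Proof.
move=> CS; have [k] := ubnP (n - rank z); elim: k z a => // k IH z a kz zC zasc aC az ha.
have /chains_aboveP[hC _ _] := CS.
have [b bC [zb hb]] := @chain_succ C (rank z) (rank_lt (proj2 (hC z zC))).
have incab : incr g a z b by apply: (ascent_neighbours CS zC zasc).
have ltzb : (z < b)%O by rewrite (ext_lt CS (extC zC) (extT bC)).
have [bD|bD] := boolP (b \in \top%O |: descents C); first by exists b.
have [bC' basc] := mem_ascent bC bD.
have [b' b'D [bb' incb]] : exists2 b', b' \in \top%O |: descents C & (b < b')%O /\ incr g z b b'.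
  apply: (IH b z) => //; first by have := ltn_ord (rank b); lia.
    by rewrite in_setU1 zC orbT.
  move=> u; rewrite in_setU1 => /orP[/eqP-> _|uC ub].
    by rewrite rank_le // ltW //; case: (hC z zC).
  by rewrite leqNgt; apply/negP => zu; move: ub; rewrite ltnNge hb // in_setU1 uC orbT.
exists b'; first exact: b'D.
split; first exact: lt_trans bb'.
have ltaz : (a < z)%O by rewrite (ext_lt CS (extU aC) (extC zC)).
exact: (incr_trans g_inj ltaz ltzb bb' incab incb).1.
Qed.

(** The lower end is now moved down in the same way. Between consecutive descents a chain thus
    follows the increasing chain, which makes it the lightest chain through its descents. *)
Lemma ascent_descents S C z : C \in chains_above x S -> z \in C -> ascent C z ->
  exists a b, [/\ a \in x |: descents C, b \in \top%O |: descents C,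
    (a < z)%O, (z < b)%O & incr g a z b].
Proof.
move=> CS; have [k] := ubnP (rank z); elim: k z => // k IH z kz zC zasc.
have /chains_aboveP[hC _ _] := CS.
have [a aC [az ha]] := @chain_pred C (rank z) (rank_lt (proj1 (hC z zC))).
have [b bD [zb incab]] := ascent_up CS zC zasc aC az ha.
have ltaz : (a < z)%O by rewrite (ext_lt CS (extU aC) (extC zC)).
have [aD|aD] := boolP (a \in x |: descents C); first by exists a, b.
have [aC' aasc] := mem_ascent aC aD.
have [|a' [b' [a'D b'D a'a ab' inca]]] := IH a _ aC' aasc; first by lia.
exists a', b; split; [exact: a'D | exact: bD | exact: lt_trans ltaz | exact: zb |].
apply: (incr_trans g_inj a'a ltaz zb _ incab).2.
(* [b'] is not below [z]: a member of the chain strictly between [a] and [z] would contradict the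
   choice of [a]. *)
apply: (incr_sub g_inj inca) => //.
have bC' : b' \in \top%O |: C.
  by move: b'D; rewrite !in_setU => /orP[->//|/(subsetP (descents_sub C))->]; rewrite orbT.
apply: (ext_le CS (extC zC) (extT bC')); rewrite leqNgt; apply/negP => b'z.
have bC'' : b' \in x |: C.
  move: bC'; rewrite in_setU1 => /orP[/eqP e|]; last exact: setU1r.
  by move: b'z; rewrite e ltnNge rank_le ?lex1.
by have := ha _ bC'' b'z; rewrite leqNgt (rank_lt ab').
Qed.

End Above.

End Chains.

(** * Cycles on the chains with a given rank set *)

(** The value at [a] involves only points of larger weight, so the iteration becomes stationary at
    [a] after [M - w a] steps. *)
Lemma triangular_system (X : finType) (K : zmodType) (r : rel X) (w : X -> nat)
    (f : X -> K) : (forall a b, r a b -> (w a < w b)%N) ->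
  exists c : X -> K, forall a, c a = f a - \sum_(b | r a b) c b.
Proof.
move=> rw; pose M := (\max_a w a).+1.
pose step (c : X -> K) a := f a - \sum_(b | r a b) c b.
have wM a : (w a < M)%N by rewrite ltnS leq_bigmax.
have stable k l a : (M - w a <= k)%N -> (M - w a <= l)%N ->
    iter k step (fun=> 0) a = iter l step (fun=> 0) a.
  elim: k l a => [|k IH] [|l] a; have := wM a; try lia; move=> wa ka la.
  by congr (_ - _); apply: eq_bigr => b /rw ab; apply: IH; have := wM b; lia.
exists (iter M step (fun=> 0)) => a; rewrite {1}/M iterS; congr (_ - _).
by apply: eq_bigr => b /rw ab; rewrite (stable (\max_a w a) M b) //; have := wM b; rewrite /M; lia.
Qed.

Section Cycles.

Variables (n : nat) (K : zmodType).
Implicit Types (z a b : setpart n) (C B Q : {set setpart n}) (S R T : {set 'I_n.+1}).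
Implicit Types c d : {set setpart n} -> K.

Section Above.

Variable x : setpart n.

(** For [Q] a chain of rank set [S :\ t] this is the gap sum at [t]; smaller [Q] give iterated gap
    sums, by [hat_select]. *)
Definition hat S c Q := \sum_(C in chains_above x S | Q \subset C) c C.

Lemma hat_select S R c Q : R \subset S -> (forall z, z \in Q -> rank z \in R) ->
  hat S c Q = hat R (hat S c) Q.
Proof.
move=> RS QR; rewrite /hat.
rewrite (partition_big (fun C => select C R)
  (fun B => (B \in chains_above x R) && (Q \subset B))) /=.
  apply: eq_bigr => B /andP[BR QB]; apply: eq_bigl => C.
  have [CS|//] := boolP (C \in chains_above x S); rewrite /= (select_eq CS BR RS).
  by case BC: (B \subset C); rewrite ?andbF // (subset_trans QB BC).
by move=> C /andP[CS QC]; rewrite (select_chain CS RS) subset_select.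
Qed.

Lemma eq_hat S c d Q : {in chains_above x S, c =1 d} -> hat S c Q = hat S d Q.
Proof. by move=> h; apply: eq_bigr => C /andP[/h]. Qed.

Definition member C (r : 'I_n.+1) := odflt \top%O [pick z in C | rank z == r].

Lemma memberP S C r : C \in chains_above x S -> r \in S ->
  member C r \in C /\ rank (member C r) = r.
Proof.
move=> CS rS; rewrite /member; case: pickP => [z /andP[zC /eqP zr] //|h].
by have [z zC zr] := chain_elt CS rS; have := h z; rewrite zC zr eqxx.
Qed.

Lemma member_eq S C z : C \in chains_above x S -> z \in C -> member C (rank z) = z.
Proof.
move=> CS zC; have [mC mr] := memberP CS (chain_rank CS zC).
exact: chain_rank_inj CS mC zC mr.
Qed.

Variable g : 'I_n -> nat.
Hypothesis g_inj : injective g.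

Definition chain_weight R B := (\sum_(r in R) weight g (member B r))%N.

(** At a rank where [B] and [C] differ, the member of [C] is an ascent. It is the increasing element
    of an interval bounded by descents of [C] or by the ends, and [B] passes through the same
    interval. *)
Lemma descents_weight S R C B : C \in chains_above x S -> R \subset S ->
  B \in chains_above x R -> descents x g C \subset B -> B != select C R ->
  (chain_weight R (select C R) < chain_weight R B)%N.
Proof.
move=> CS RS BR DB neq; have sCR := select_chain CS RS.
have key r : r \in R -> member (select C R) r != member B r ->
    (weight g (member (select C R) r) < weight g (member B r))%N.
  move=> rR; have [zC zr] := memberP sCR rR; have [z'B z'r] := memberP BR rR.
  move: zC; set z := member _ r in zr *; set z' := member B r in z'B z'r *.
  move=> zC zz'; have {}zC : z \in C by move: zC; rewrite inE => /andP[].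
  have zasc : ascent x g C z.
    apply: contraNT zz' => h; have zD : z \in descents x g C by rewrite inE zC.
    by apply/eqP/(chain_rank_inj BR (subsetP DB _ zD) z'B); rewrite z'r.
  have [a [b [aD bD az zb h]]] := ascent_descents g_inj CS zC zasc.
  have rzz : rank z' = rank z by rewrite z'r.
  have [xz' z'T] : (x < z')%O /\ (z' < \top)%O by case/chains_aboveP: BR => /(_ _ z'B).
  have az' : (a < z')%O.
    move: aD; rewrite in_setU1 => /orP[/eqP->//|/(subsetP DB) aB].
    by rewrite (chain_lt BR aB z'B) rzz rank_lt.
  have z'b : (z' < b)%O.
    move: bD; rewrite in_setU1 => /orP[/eqP->//|/(subsetP DB) bB].
    by rewrite (chain_lt BR z'B bB) rzz rank_lt.
  by apply: (incr_weight g_inj (ltW az) (ltW zb) (ltW az') (ltW z'b) h rzz); rewrite eq_sym.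
have [r rR ne] : exists2 r, r \in R & member (select C R) r != member B r.
  apply/exists_inP; apply: contraNT neq; rewrite negb_exists_in => /forall_inP h.
  apply/eqP/(chain_sub_eq BR sCR)/subsetP => z zB.
  have rzR := chain_rank BR zB; have /negPn/eqP := h _ rzR.
  by rewrite (member_eq BR zB) => <-; case: (memberP sCR rzR).
rewrite /chain_weight (bigD1 r rR) [X in (_ < X)%N](bigD1 r rR) /= -addSn.
apply: leq_add; first exact: key.
apply: leq_sum => s /andP[sR _].
by have [->//|/(key s sR)/ltnW] := eqVneq (member (select C R) s) (member B s).
Qed.

Lemma select_id S C : C \in chains_above x S -> select C S = C.
Proof.
move=> CS; apply/eqP; rewrite (select_eq CS CS) //.
Qed.

(** There is one equation for each chain, at its own descents. Since a chain is the lightest one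
    through its descents, the system is triangular with ones on the diagonal. *)
Lemma hat_descents_solve S (f : {set setpart n} -> K) : exists2 c,
  forall C, C \notin chains_above x S -> c C = 0 &
  forall C, C \in chains_above x S -> hat S c (descents x g C) = f C.
Proof.
pose r C C' := [&& C \in chains_above x S, C' \in chains_above x S,
  descents x g C \subset C' & C' != C].
have [|c hc] := @triangular_system _ _ r (chain_weight S)
    (fun C => if C \in chains_above x S then f C else 0).
  move=> C C' /and4P[CS C'S D ne]; rewrite -{1}(select_id CS).
  by apply: (@descents_weight S S C C') => //; rewrite select_id.
exists c => C CS.
  by rewrite hc (negPf CS) big1 ?subr0 // => B /and4P[]; rewrite (negPf CS).
rewrite /hat (bigD1 C) /= ?CS ?descents_sub // hc CS.
rewrite [X in _ - X + _](eq_bigl (fun B =>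
  ((B \in chains_above x S) && (descents x g C \subset B)) && (B != C))) ?subrK //.
by move=> B; rewrite /r CS /= andbA.
Qed.

(** The gap is filled with the increasing element between the neighbours of rank below and above
    [t]; this element is an ascent. *)
Lemma chain_fill S t B : t \in S -> (rank x < t)%N -> (t < rank (\top%O : setpart n))%N ->
  B \in chains_above x (S :\ t) ->
  exists C, [/\ C \in chains_above x S, select C (S :\ t) = B &
    forall z, z \in descents x g C -> rank z \in S :\ t].
Proof.
move=> tS xt tT BS; have /chains_aboveP[h1 h2 h3] := BS.
have [a aB [ar ha]] := chain_pred B xt.
have [b bB [br hb]] := chain_succ B tT.
have aE : a \in x |: (\top%O |: B) by move: aB; rewrite !in_setU => /orP[->|->]; rewrite ?orbT.
have bE : b \in x |: (\top%O |: B) by rewrite in_setU bB orbT.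
have BE u : u \in B -> u \in x |: (\top%O |: B) by rewrite !in_setU => ->; rewrite !orbT.
have ab : (a < b)%O by rewrite (ext_lt BS aE bE) (ltn_trans ar br).
have [z [az zb zr hz]] := incr_exists g_inj ab ar br.
have {}zr : rank z = t by apply: val_inj.
have zcmp u : u \in B -> (u < z)%O || (z < u)%O.
  move=> uB; have := chain_rank BS uB; rewrite in_setD1 => /andP[ut _].
  case: (ltngtP (rank u) t) => [lt|gt|e]; last by case/eqP: ut; apply: val_inj.
    apply/orP; left; apply: le_lt_trans az.
    by apply: (ext_le BS (BE u uB) aE); apply: ha => //; rewrite in_setU1 uB orbT.
  apply/orP; right; apply: lt_le_trans zb _.
  by apply: (ext_le BS bE (BE u uB)); apply: hb => //; rewrite in_setU1 uB orbT.
have xa : (x <= a)%O by move: aB; rewrite in_setU1 => /orP[/eqP->//|/h1[/ltW]].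
have CS : z |: B \in chains_above x S.
  apply/chains_aboveP; split.
  - move=> u; rewrite in_setU1 => /orP[/eqP->|/h1//]; split; first exact: le_lt_trans az.
    exact: lt_le_trans zb (lex1 _).
  - move=> u v; rewrite !in_setU1 => /orP[/eqP->|uB] /orP[/eqP->|vB].
    + exact: comparablexx.
    + by case/orP: (zcmp v vB) => [/gt_comparable|/lt_comparable].
    + by case/orP: (zcmp u uB) => [/lt_comparable|/gt_comparable].
    + exact: h2.
  by rewrite imsetU1 h3 zr setD1K.
have DS : S :\ t \subset S by rewrite subsetDl.
exists (z |: B); split=> //.
  by apply/eqP; rewrite (select_eq CS BS DS) subsetUr.
move=> u; rewrite [u \in _]inE => /andP[uC uasc]; rewrite in_setD1 (chain_rank CS uC) andbT.
apply: contraNneq uasc => e; apply/ascentP; exists a, b.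
have -> : u = z by apply: (chain_rank_inj CS uC); rewrite ?setU11 // e.
split; [idtac | idtac | exact: az | exact: zb | exact: hz].
  by move: aB; rewrite !in_setU => /orP[->|->]; rewrite ?orbT.
by move: bB; rewrite !in_setU => /orP[->|->]; rewrite ?orbT.
Qed.

(** Each chain [B] of rank set [S :\ t] has a filling [C] without descent at [t], and [B] is the
    lightest chain of its rank set through the descents of [C]. The equations thus determine the
    values, from the heaviest chain down. *)
Lemma hat_descents_inj S t c d : t \in S -> (rank x < t)%N ->
  (t < rank (\top%O : setpart n))%N ->
  (forall C, C \in chains_above x S ->
    (forall z, z \in descents x g C -> rank z \in S :\ t) ->
    hat (S :\ t) c (descents x g C) = hat (S :\ t) d (descents x g C)) ->
  {in chains_above x (S :\ t), c =1 d}.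
Proof.
move=> tS xt tT h B; pose M := \max_B chain_weight (S :\ t) B.
have wM A : (chain_weight (S :\ t) A <= M)%N by apply: leq_bigmax.
have [k] := ubnP (M - chain_weight (S :\ t) B); elim: k B => // k IH B kB BS.
have [C [CS CB Dt]] := chain_fill tS xt tT BS.
have DB : descents x g C \subset B by rewrite -CB subset_select // descents_sub.
have := h C CS Dt; rewrite /hat (bigD1 B) ?BS //= [in RHS](bigD1 B) ?BS //=.
set s1 := bigop _ _ _; set s2 := bigop _ _ _; suff -> : s1 = s2 by move/addIr.
apply: eq_bigr => A /andP[/andP[AS DA] neq]; apply: IH => //.
have := @descents_weight S (S :\ t) C A CS (subsetDl _ _) AS DA.
by rewrite CB => /(_ neq); have := wM A; lia.
Qed.

Lemma hat_eq0 S t c : (forall B, B \in chains_above x (S :\ t) -> hat S c B = 0) ->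
  forall Q, (forall z, z \in Q -> rank z \in S :\ t) -> hat S c Q = 0.
Proof.
move=> h Q QS; rewrite (hat_select _ (subsetDl S [set t]) QS).
by apply: big1 => B /andP[/h].
Qed.

(** The conditions are restricted to a set [T] of ranks so that they can be added one rank at a
    time. *)
Definition cycle S T c := forall t, t \in T ->
  forall B, B \in chains_above x (S :\ t) -> hat S c B = 0.

(** [c] is prescribed through its sums over the chains containing given descents. These sums are
    forced by [d] when the descents avoid rank [t], and are set to zero otherwise. *)
Lemma hat_surj S T t d :
  {in S, forall r : 'I_n.+1, (rank x < r < rank (\top%O : setpart n))%N} ->
  t \in S -> T \subset S -> t \notin T -> cycle (S :\ t) T d ->
  exists c, [/\ forall C, C \notin chains_above x S -> c C = 0,
    cycle S T c & {in chains_above x (S :\ t), hat S c =1 d}].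
Proof.
move=> hS tS TS tT hd.
pose f C := if [forall z in descents x g C, rank z \in S :\ t]
            then hat (S :\ t) d (descents x g C) else 0.
have [c c0 hc] := hat_descents_solve S f.
have /andP[xt tt] := hS t tS.
exists c; split=> //; last first.
  apply: (hat_descents_inj tS xt tt) => C CS Dt.
  by rewrite -hat_select ?subsetDl // hc // /f; case: forall_inP.
move=> t' t'T B BS; have t'S := subsetP TS _ t'T; have /andP[xt' tt'] := hS t' t'S.
suff : {in chains_above x (S :\ t'), hat S c =1 fun=> 0} by apply.
(* It suffices to test descent sets avoiding [t']. There [f] is zero or a sum of [d] over the chains
   through such a set, which vanishes by the cycle condition on [d]. *)
apply: (hat_descents_inj t'S xt' tt') => C CS Dt'.
rewrite -hat_select ?subsetDl // hc // [RHS]big1 // /f; case: forall_inP => // Dt.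
apply: (hat_eq0 (hd t' t'T)) => z zD.
by rewrite in_setD1 (Dt z zD) andbT; move: (Dt' z zD); rewrite in_setD1 => /andP[].
Qed.

End Above.
End Cycles.

(** * Growing chains *)

Section Growing.

Variables (n : nat) (K : zmodType).
Implicit Types (x y z a b : setpart n) (C B Q : {set setpart n}) (S R T : {set 'I_n.+1}).
Implicit Types c d f : {set setpart n} -> K.

Lemma member_sub x S R B C (s : 'I_n.+1) : C \in chains_above x S -> B \in chains_above x R ->
  B \subset C -> s \in R -> member C s = member B s.
Proof.
move=> CS BR BC sR; have [mB ms] := memberP BR sR.
by rewrite -{1}ms (member_eq CS) // (subsetP BC).
Qed.

(** An element satisfying [gr] at the lowest rank [s] is always a descent. All chains through the
    descents of such a chain share its member of rank [s], so these chains have a closed subsystem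
    of equations, which [d] solves; the other right-hand sides are zero. *)
Lemma hat_extend x (g : 'I_n -> nat) S s (gr : pred (setpart n)) d :
  injective g ->
  {in S, forall r : 'I_n.+1, (rank x < r < rank (\top%O : setpart n))%N} ->
  s \in S -> {in S, forall r : 'I_n.+1, (s <= r)%N} ->
  (forall z y, gr z -> (x < z)%O -> (z < y)%O -> ~~ incr g x z y) ->
  (forall t B, t \in S -> t != s -> B \in chains_above x (S :\ t) ->
     gr (member B s) -> hat x S d B = 0) ->
  exists c, [/\ forall C, C \notin chains_above x S -> c C = 0, cycle x S S c &
    forall C, C \in chains_above x S -> gr (member C s) -> c C = d C].
Proof.
move=> g_inj hS sS smin hgr hd.
pose f C := if gr (member C s) then hat x S d (descents x g C) else 0.
have [c c0 hc] := hat_descents_solve x g_inj S f.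
have sD C : C \in chains_above x S -> gr (member C s) -> member C s \in descents x g C.
  move=> CS grC; have [zC zs] := memberP CS sS; rewrite inE zC.
  apply/negP => /ascentP[a [b [aC _ az zb h]]].
  have /chains_aboveP[/(_ _ zC)[xz _] _ _] := CS.
  move: aC; rewrite in_setU1 => /orP[/eqP e|aC].
    by move: h; rewrite e; apply/negP/hgr.
  by have := rank_lt az; rewrite zs ltnNge smin ?(chain_rank CS aC).
have memD C B : C \in chains_above x S -> gr (member C s) -> B \in chains_above x S ->
    descents x g C \subset B -> member B s = member C s.
  move=> CS grC BS DB; have [zC zs] := memberP CS sS.
  by rewrite -{1}zs (member_eq BS) // (subsetP DB) // sD.
exists c; split=> //; last first.
  move=> C; pose M := \max_B chain_weight g S B.
  have wM A : (chain_weight g S A <= M)%N by apply: leq_bigmax.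
  have [k] := ubnP (M - chain_weight g S C); elim: k C => // k IH C kC CS grC.
  have := hc C CS; rewrite /f grC /hat (bigD1 C) ?CS ?descents_sub //=.
  rewrite [in RHS](bigD1 C) ?CS ?descents_sub //=.
  set s1 := bigop _ _ _; set s2 := bigop _ _ _; suff -> : s1 = s2 by move/addIr.
  apply: eq_bigr => A /andP[/andP[AS DA] neq].
  apply: IH => //; last by rewrite (memD C A).
  have := @descents_weight n x g g_inj S S C A CS (subxx _) AS DA.
  by rewrite (select_id CS) => /(_ neq); have := wM A; lia.
move=> t tS B BS; have /andP[xt tT] := hS t tS.
suff : {in chains_above x (S :\ t), hat x S c =1 fun=> 0} by apply.
apply: (hat_descents_inj g_inj tS xt tT) => C CS Dt.
rewrite -hat_select ?subsetDl // hc // [RHS]big1 // /f; case: ifP => // grC.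
(* The member of rank [s] is a descent, whereas the descents of [C] avoid rank [t]. *)
have ts : t != s.
  apply/eqP => ts; have := Dt _ (sD C CS grC); rewrite in_setD1 ts.
  by case: (memberP CS sS) => _ ->; rewrite eqxx.
rewrite (hat_select _ _ (subsetDl S [set t]) Dt); apply: big1 => A /andP[AS DA].
apply: (hd t) => //; have [zC zs] := memberP CS sS.
by rewrite -zs (member_eq AS) // (subsetP DA) // sD.
Qed.

Lemma chain_behead x S C (s : 'I_n.+1) z : C \in chains_above x S ->
  {in S, forall r : 'I_n.+1, (s <= r)%N} -> z \in C -> rank z = s ->
  C :\ z \in chains_above z (S :\ s).
Proof.
move=> CS smin zC zs; have /chains_aboveP[h1 h2 h3] := CS; apply/chains_aboveP; split.
- move=> u; rewrite in_setD1 => /andP[uz uC]; split; last by case: (h1 _ uC).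
  rewrite (chain_lt CS zC uC) ltn_neqAle zs smin ?(chain_rank CS uC) // andbT.
  apply: contraNneq uz => e; apply/eqP/(chain_rank_inj CS uC zC).
  by rewrite zs; apply/val_inj/esym/e.
- by move=> u v; rewrite !in_setD1 => /andP[_ uC] /andP[_ vC]; apply: h2.
apply/setP => r; rewrite in_setD1; apply/imsetP/andP => [[u]|[rs rS]].
  rewrite in_setD1 => /andP[uz uC] ->; rewrite (chain_rank CS uC); split=> //.
  by apply: contraNneq uz => e; apply/eqP/(chain_rank_inj CS uC zC); rewrite e.
have [u uC ur] := chain_elt CS rS; exists u => //.
by rewrite in_setD1 uC andbT; apply: contraNneq rs => e; rewrite -ur e zs.
Qed.

Lemma chain_cons x S C z : (x < z)%O -> (z < \top)%O -> rank z \in S ->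
  C \in chains_above z (S :\ rank z) -> z |: C \in chains_above x S.
Proof.
move=> xz zT zS /chains_aboveP[h1 h2 h3]; apply/chains_aboveP; split.
- move=> u; rewrite in_setU1 => /orP[/eqP->//|/h1[zu uT]]; split=> //.
  exact: lt_trans zu.
- move=> u v; rewrite !in_setU1 => /orP[/eqP->|uC] /orP[/eqP->|vC].
  + exact: comparablexx.
  + by apply: lt_comparable; case: (h1 v vC).
  + by apply: gt_comparable; case: (h1 u uC).
  + exact: h2.
by rewrite imsetU1 h3 setD1K.
Qed.

Lemma hat_cons x S (s : 'I_n.+1) z B (f : {set setpart n} -> K) : (x < z)%O -> (z < \top)%O ->
  rank z = s -> s \in S -> {in S, forall r : 'I_n.+1, (s <= r)%N} -> z \in B ->
  \sum_(C in chains_above x S | B \subset C) f (C :\ z) = hat z (S :\ s) f (B :\ z).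
Proof.
move=> xz zT zs sS smin zB; rewrite /hat.
have zN C : C \in chains_above z (S :\ s) -> z \notin C.
  by case/chains_aboveP => h _ _; apply/negP => /h[]; rewrite ltxx.
rewrite (reindex_onto (fun C => z |: C) (fun C => C :\ z)) /=; last first.
  by move=> C /andP[_ BC]; rewrite setD1K // (subsetP BC).
apply: congr_big => // [C|C /andP[_ /eqP-> //]].
apply/andP/andP => [[/andP[CS BC] /eqP e]|[CS BC]].
  split; first by rewrite -e; apply: (chain_behead CS smin); rewrite ?setU11.
  by rewrite subDset.
rewrite setU1K ?zN // eqxx; split=> //; rewrite -subDset BC andbT.
by apply: chain_cons; rewrite ?zs.
Qed.

Variable m : 'I_n.

Definition grows x z := [exists u, same z m u && ~~ same x m u].

Definition growing x C := forall z a, z \in C -> a \in x |: C -> (a < z)%O -> grows a z.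

Definition last_label x (u : 'I_n) := (if same x m u then u + n else u)%N.

Lemma last_label_inj x : injective (last_label x).
Proof.
move=> u v; rewrite /last_label => e; apply: val_inj; move: e => /=.
by have := ltn_ord u; have := ltn_ord v; case: ifP; case: ifP; lia.
Qed.

(* When the labels of the marked block of [x] come last, a step that enlarges
   this block removes the last possible label, so it cannot be followed by a
   larger one. *)
Lemma grows_not_incr x z y : grows x z -> (x < z)%O -> (z < y)%O ->
  ~~ incr (last_label x) x z y.
Proof.
move=> /existsP[u /andP[zu xu]] xz zy; have i := @last_label_inj x.
set g := last_label x in i *; pose a := block_min g x m.
have xa : same x m a := block_min_same g x m.
have ga : (n <= g a)%N by rewrite /g /last_label xa leq_addl.
have az : a \in nonmin g z.
  apply/(nonminP i); exists u.
    by apply: same_trans zu; rewrite same_sym; apply: le_same xa; apply: ltW.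
  by apply: leq_trans ga; rewrite /g /last_label (negPf xu) ltn_ord.
have /properP[_ [v vy vz]] := nonmin_lt i zy.
apply/negP => /incrP/(_ a v az (block_min_nonmin i x m) vy vz); apply/negP.
have vx : v \notin nonmin g x by apply: contra vz; apply: (subsetP (nonmin_le i (ltW xz))).
rewrite -leqNgt ltnW // (leq_trans _ ga) // /g /last_label ifN ?ltn_ord //.
apply: contra vz => xv; suff -> : v = a by [].
by rewrite /a (eq_block_min i xv) block_min_id.
Qed.

(** Induction on the size of [S]: each candidate [z] for the lowest member receives a cycle above
    it, and [hat_extend] glues these along the growing first steps, with labels adapted to [x]. *)
Lemma growing_cycle x S (f : {set setpart n} -> K) :
  {in S, forall r : 'I_n.+1, (rank x < r < rank (\top%O : setpart n))%N} ->
  exists c, [/\ forall C, C \notin chains_above x S -> c C = 0, cycle x S S c &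
    forall C, C \in chains_above x S -> growing x C -> c C = f C].
Proof.
have [k] := ubnP #|S|; elim: k x S f => // k IH x S f kS hS.
have [->|/set0Pn[s0 s0S]] := eqVneq S set0.
  exists (fun C => if C \in chains_above x set0 then f C else 0); split.
  - by move=> C /negbTE->.
  - by move=> t; rewrite in_set0.
  - by move=> C ->.
pose s := [arg min_(r < s0 in S) (r : nat)].
have [sS smin] : s \in S /\ {in S, forall r : 'I_n.+1, (s <= r)%N}.
  by rewrite /s; case: arg_minnP.
(* The rank is a premise inside [P], so that the cycles can be chosen for all [z] at once. *)
pose P z (c : {set setpart n} -> K) := rank z = s -> 
  [/\ forall C, C \notin chains_above z (S :\ s) -> c C = 0,
   cycle z (S :\ s) (S :\ s) c &
   forall C, C \in chains_above z (S :\ s) -> growing z C -> c C = f (z |: C)].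
have [z|F hF] := @fin_all_exists (setpart n) (fun=> {set setpart n} -> K) P.
  have [zs|zs] := eqVneq (rank z) s; last by exists (fun=> 0) => /eqP; rewrite (negPf zs).
  have [||c hc] := IH z (S :\ s) (fun C => f (z |: C)); last by exists c.
    by move: kS; rewrite (cardsD1 s S) sS.
  move=> r; rewrite in_setD1 => /andP[rs rS]; have /andP[_ ->] := hS r rS.
  rewrite zs andbT ltn_neqAle smin // andbT.
  by apply: contraNneq rs => e; apply/eqP/val_inj.
pose d C := F (member C s) (C :\ member C s).
have [t B tS ts BS grB|c [c0 hc hcd]] := @hat_extend x _ S s (grows x) d
    (@last_label_inj x) hS sS smin (@grows_not_incr x).
  have sSt : s \in S :\ t by rewrite in_setD1 sS eq_sym ts.
  have [zB zs] := memberP BS sSt; set z := member B s in zB zs grB.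
  have /chains_aboveP[/(_ z zB)[xz zT] _ _] := BS.
  rewrite /hat (eq_bigr (fun C => F z (C :\ z))); last first.
    by move=> C /andP[CS BC]; rewrite /d (member_sub CS BS BC sSt).
  rewrite (hat_cons _ xz zT zs sS smin zB).
  have [_ h _] := hF z zs; apply: (h t); first by rewrite in_setD1 ts.
  have := @chain_behead x (S :\ t) B s z BS _ zB zs.
  rewrite !setDDl [[set s] :|: _]setUC; apply.
  by move=> r; rewrite in_setD1 => /andP[_ /smin].
exists c; split=> // C CS gC; have [zC zs] := memberP CS sS.
have /chains_aboveP[/(_ _ zC)[xz zT] _ _] := CS.
rewrite hcd ?gC ?setU11 // /d; have [_ _ h] := hF _ zs.
rewrite (h _ (chain_behead CS smin zC zs)) ?setD1K //.
move=> u a; rewrite in_setD1 => /andP[_ uC]; rewrite setD1K // => aC.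
by apply: gC; rewrite // in_setU1 aC orbT.
Qed.

End Growing.

(** * Invariant cycles *)

Section InvariantCycles.

Variables (n : nat) (H : {group 'S_n}).
Implicit Types (x y z a b : setpart n) (C B Q : {set setpart n}) (S R T : {set 'I_n.+1}).

Notation act := (chain_action n).

Lemma act_subset (h : 'S_n) B C : (act B h \subset act C h) = (B \subset C).
Proof.
apply/idP/idP; last exact: imsetS.
by move/(imsetS (setpart_action n ^~ h^-1%g)); rewrite -!setactE !actK.
Qed.

Lemma act_chains (h : 'S_n) S C : (act C h \in chains S) = (C \in chains S).
Proof. by have /astabsP -> := subsetP (chains_acts S) h (in_setT _). Qed.

Lemma hat_act (K : zmodType) (c : {set setpart n} -> K) (h : 'S_n) S B :
  hat \bot%O S (fun C => c (act C h)) B = hat \bot%O S c (act B h).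
Proof.
rewrite /hat !chains_above_bot [RHS](reindex_inj (act_inj act h)).
by apply: eq_bigl => C; rewrite act_chains act_subset.
Qed.

Notation V := {ffun {set setpart n} -> algC^o}.

(** This map and the next two turn the conditions into kernels: support on the chains of rank set
    [S], invariance under [H], and the gap condition at [t]. *)
Definition off_chains S (c : V) : V := [ffun C => if C \in chains S then 0 else c C].
Definition translate (h : 'S_n) (c : V) : V := [ffun C => c (act C h) - c C].
Definition fill_sum S (t : 'I_n.+1) (c : V) : V :=
  [ffun B => if B \in chains (S :\ t) then hat \bot%O S c B else 0].

Fact off_chains_linear S : linear (off_chains S).
Proof.
by move=> k c d; apply/ffunP => C; rewrite !ffunE; case: ifP; rewrite ?scaler0 ?addr0.
Qed.
HB.instance Definition _ S :=
  GRing.isLinear.Build algC V V *:%R (off_chains S) (off_chains_linear S).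

Fact translate_linear h : linear (translate h).
Proof.
by move=> k c d; apply/ffunP => C; rewrite !ffunE scalerBr opprD addrACA.
Qed.
HB.instance Definition _ h :=
  GRing.isLinear.Build algC V V *:%R (translate h) (translate_linear h).

Fact fill_sum_linear S t : linear (fill_sum S t).
Proof.
move=> k c d; apply/ffunP => B; rewrite !ffunE; case: ifP; last by rewrite scaler0 addr0.
rewrite /hat scaler_sumr -big_split => _; apply: eq_bigr => C _.
by rewrite !ffunE.
Qed.
HB.instance Definition _ S t :=
  GRing.isLinear.Build algC V V *:%R (fill_sum S t) (fill_sum_linear S t).

Definition inv_cycles S T : {vspace V} :=
  (lker (linfun (off_chains S)) :&: \bigcap_(h in H) lker (linfun (translate h))
    :&: \bigcap_(t in T) lker (linfun (fill_sum S t)))%VS.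

Lemma memv_bigcap_lker (I : finType) (P : pred I) (F : I -> 'End(V)) (c : V) :
  reflect (forall i, P i -> F i c = 0) (c \in \bigcap_(i | P i) lker (F i))%VS.
Proof.
rewrite memvE; apply: (iffP subv_bigcapP) => [h i /h|h i /h]; rewrite -memvE memv_ker => /eqP //.
Qed.

Lemma inv_cyclesP S T (c : V) : reflect
  [/\ forall C, C \notin chains S -> c C = 0,
      forall h C, h \in H -> c (act C h) = c C & cycle \bot%O S T c]
  (c \in inv_cycles S T).
Proof.
rewrite !memv_cap memv_ker lfunE /=.
apply: (iffP idP) => [/andP[/andP[/eqP/ffunP h1 /memv_bigcap_lker h2] /memv_bigcap_lker h3]|].
  split.
  - by move=> C CS; have := h1 C; rewrite !ffunE (negPf CS).
  - by move=> h C /h2; rewrite lfunE => /ffunP/(_ C); rewrite !ffunE => /subr0_eq.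
  - move=> t /h3; rewrite lfunE chains_above_bot => /ffunP e B BS.
    by have := e B; rewrite !ffunE BS.
move=> [h1 h2 h3]; apply/andP; split; first (apply/andP; split).
- by apply/eqP/ffunP => C; rewrite !ffunE; case: ifPn => // /h1.
- by apply/memv_bigcap_lker => h hH; rewrite lfunE; apply/ffunP => C; rewrite !ffunE h2 // subrr.
- apply/memv_bigcap_lker => t tT; rewrite lfunE; apply/ffunP => B; rewrite !ffunE.
  by case: ifP => // BS; apply: (h3 t) => //; rewrite chains_above_bot.
Qed.

Definition average (c : {set setpart n} -> algC) : V :=
  [ffun C => #|H|%:R^-1 * \sum_(h in H) c (act C h)].

Lemma average_const (a : algC) : #|H|%:R^-1 * (\sum_(h in H) a) = a.
Proof.
by rewrite sumr_const -[a *+ _]mulr_natl mulKf // pnatr_eq0 -lt0n cardG_gt0.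
Qed.

Lemma average_inv (c : {set setpart n} -> algC) h C : h \in H -> average c (act C h) = average c C.
Proof.
move=> hH; rewrite !ffunE; congr (_ * _).
rewrite [RHS](reindex_inj (mulgI h)) /=; apply: eq_big => [k|k _]; first by rewrite groupMl.
by rewrite actM.
Qed.

Lemma average_id (c : {set setpart n} -> algC) C :
  (forall h, h \in H -> c (act C h) = c C) -> average c C = c C.
Proof.
by move=> hc; rewrite ffunE (eq_bigr (fun=> c C)) // average_const.
Qed.

Lemma hat_average (c : {set setpart n} -> algC) S B :
  hat \bot%O S (average c) B = #|H|%:R^-1 * \sum_(h in H) hat \bot%O S c (act B h).
Proof.
rewrite /hat (eq_bigr (fun C => #|H|%:R^-1 * \sum_(h in H) c (act C h))); last first.
  by move=> C _; rewrite ffunE.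
rewrite -mulr_sumr exchange_big /=; congr (_ * _); apply: eq_bigr => h _.
exact: (hat_act c h S B).
Qed.

Lemma average_cycle (c : {set setpart n} -> algC) S T :
  (forall C, C \notin chains S -> c C = 0) -> cycle \bot%O S T c ->
  average c \in inv_cycles S T.
Proof.
move=> c0 hc; apply/inv_cyclesP; split.
- by move=> C CS; rewrite ffunE big1 ?mulr0 // => h _; rewrite c0 // act_chains.
- by move=> h C; apply: average_inv.
move=> t tT B BS; rewrite hat_average big1 ?mulr0 // => h _; apply: (hc t) => //.
by move: BS; rewrite !chains_above_bot act_chains.
Qed.

(** Gap sums at different ranks commute, which gives one inclusion. For the other, a preimage from
    [hat_surj], with the usual labels, is averaged over [H]. *)
Lemma fill_sum_image S T t :
  {in S, forall r : 'I_n.+1, (rank (\bot%O : setpart n) < r < rank (\top%O : setpart n))%N} ->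
  t \in S -> T \subset S -> t \notin T ->
  (linfun (fill_sum S t) @: inv_cycles S T = inv_cycles (S :\ t) T)%VS.
Proof.
move=> hS tS TS tT; have sub r : r \in T -> t \in S :\ r.
  by move=> rT; rewrite in_setD1 tS andbT; apply: contraNneq tT => ->.
apply/eqP; rewrite eqEsubv; apply/andP; split; apply/subvP => d.
  move=> /memv_imgP[c /inv_cyclesP[c0 cinv hc] ->]; rewrite lfunE /=.
  have key B : B \in chains (S :\ t) -> fill_sum S t c B = hat \bot%O S c B.
    by move=> BS; rewrite ffunE BS.
  apply/inv_cyclesP; split.
  - by move=> C CS; rewrite ffunE (negPf CS).
  - move=> h C hH; rewrite !ffunE act_chains; case: ifP => // _.
    by rewrite -hat_act; apply: eq_hat => B _; apply: cinv.
  move=> r rT B BS; rewrite (eq_hat (d := hat \bot%O S c)); last first.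
    by move=> C; rewrite chains_above_bot; apply: key.
  have Bst z : z \in B -> rank z \in S :\ t :\ r by apply: chain_rank BS.
  rewrite -hat_select ?subsetDl //; last by move=> z /Bst; rewrite in_setD1 => /andP[].
  by apply: (hat_eq0 (hc r rT)) => z /Bst; rewrite !in_setD1 => /and3P[-> _ ->].
move=> /inv_cyclesP[d0 dinv hd].
have [c [c0 hc hcd]] := @hat_surj n algC \bot%O val val_inj S T t d hS tS TS tT hd.
apply/memv_imgP; exists (average c).
  by apply: average_cycle hc => C CS; apply: c0; rewrite chains_above_bot.
rewrite lfunE /=; apply/ffunP => B; rewrite ffunE; case: ifPn => [BS|/d0 //].
rewrite hat_average (eq_bigr (fun=> d B : algC)); last first.
  move=> h hH; rewrite hcd; first exact: dinv.
  by rewrite chains_above_bot act_chains.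
exact: (esym (average_const (d B))).
Qed.

(** Rank-nullity for the gap sum at [t], whose kernel on these cycles adds the condition at [t]. *)
Lemma dim_inv_cycles_step S T t :
  {in S, forall r : 'I_n.+1, (rank (\bot%O : setpart n) < r < rank (\top%O : setpart n))%N} ->
  t \in S -> T \subset S -> t \notin T ->
  (\dim (inv_cycles S (t |: T)) + \dim (inv_cycles (S :\ t) T) = \dim (inv_cycles S T))%N.
Proof.
move=> hS tS TS tT; rewrite -(fill_sum_image hS tS TS tT).
rewrite -(limg_ker_dim (linfun (fill_sum S t)) (inv_cycles S T)); congr (\dim _ + _)%N.
by rewrite /inv_cycles big_setU1 //= [X in (_ :&: X)%VS]capvC capvA.
Qed.

(** The recursion removes the conditions one by one; the subsets [R] are split according to whether
    they contain [t]. *)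
Lemma dim_inv_cycles S T :
  {in S, forall r : 'I_n.+1, (rank (\bot%O : setpart n) < r < rank (\top%O : setpart n))%N} ->
  T \subset S ->
  (\dim (inv_cycles S T))%:R = \sum_(R : {set 'I_n.+1} | (S :\: T \subset R) && (R \subset S))
     (-1) ^+ #|S :\: R| * (\dim (inv_cycles R set0))%:R :> algC.
Proof.
have [k] := ubnP #|T|; elim: k S T => // k IH S T kT hS TS.
have [->|/set0Pn[t tT]] := eqVneq T set0.
  rewrite setD0 (big_pred1 S) => [|R]; first by rewrite setDv cards0 expr0 mul1r.
  by rewrite /= eqEsubset andbC.
have tS := subsetP TS _ tT; pose T' := T :\ t.
have TS' : T' \subset S by apply: subset_trans TS; apply: subsetDl.
have tT' : t \notin T' by rewrite in_setD1 eqxx.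
have TE : t |: T' = T by rewrite setD1K.
have kT' : (#|T'| < k)%N by move: kT; rewrite (cardsD1 t T) tT.
have := dim_inv_cycles_step hS tS TS' tT'; rewrite TE => e.
have subn_eq (i j l : nat) : (i + j)%N = l -> i%:R = l%:R - j%:R :> algC.
  by move=> <-; rewrite natrD addrK.
have hS' : {in S :\ t, forall r : 'I_n.+1,
    (rank (\bot%O : setpart n) < r < rank (\top%O : setpart n))%N}.
  by move=> r; rewrite in_setD1 => /andP[_ /hS].
have TSt : T' \subset S :\ t by rewrite subsetD1 TS'.
apply: (etrans (subn_eq _ _ _ e)).
apply: (etrans (f_equal2 (fun a b : algC => a - b) (IH _ _ kT' hS TS') (IH _ _ kT' hS' TSt))).
rewrite [RHS](bigID (fun R : {set 'I_n.+1} => t \in R)) /= -sumrN; congr (_ + _).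
  apply: eq_bigl => R; rewrite andbAC; congr (_ && _).
  rewrite -TE setDUr; apply/idP/andP => [h|[h tR]].
    split; last by apply: (subsetP h); rewrite in_setD tT'.
    by apply: subset_trans h; rewrite subsetIr.
  apply/subsetP => r rS; have [->//|rt] := eqVneq r t.
  by apply: (subsetP h); move: rS; rewrite in_setI !in_setD in_set1 rt => /andP[-> ->].
apply: eq_big => R.
  by rewrite subsetD1 andbA -TE setDDl.
move=> /andP[_]; rewrite subsetD1 => /andP[RS tR].
rewrite -mulNr; congr (_ * _); rewrite [in RHS](cardsD1 t) in_setD tR tS exprS mulN1r.
by rewrite setDDl setUC -setDDl.
Qed.

End InvariantCycles.

(** * Orbit counts and the multiplicity of the trivial character *)

Section Multiplicity.

Variables (n : nat) (H : {group 'S_n}).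
Implicit Types (C B Q : {set setpart n}) (S R T : {set 'I_n.+1}).

Notation act := (chain_action n).
Notation V := {ffun {set setpart n} -> algC^o}.

(** Without gap conditions, an invariant function is given by arbitrary values on orbit
    representatives. *)
Lemma dim_inv_chains S :
  \dim (inv_cycles H S set0) = #|orbit act H @: chains S|.
Proof.
set Om := orbit act H @: chains S; set U := inv_cycles H S set0.
pose rep (o : {set {set setpart n}}) := odflt set0 [pick C in o].
have repP o : o \in Om -> rep o \in o.
  case/imsetP => C _ ->; rewrite /rep; case: pickP => [//|/(_ C)].
  by rewrite orbit_refl.
have orbitE o C : o \in Om -> C \in o -> o = orbit act H C.
  by case/imsetP => B _ -> /orbit_eqP ->.
have chainE o C : o \in Om -> C \in o -> C \in chains S.
  by case/imsetP => B BS -> /imsetP[h _ ->]; rewrite act_chains.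
pose ev (i : 'I_#|Om|) : {set {set setpart n}} := enum_val i.
have evP i : ev i \in Om by apply: enum_valP.
pose W := {ffun 'I_#|Om| -> algC^o}.
pose rho (c : V) : W := [ffun i => c (rep (ev i))].
have rho_lin : linear rho by move=> k c d; apply/ffunP => i; rewrite !ffunE.
pose Rho : {linear V -> W} := HB.pack rho (GRing.isLinear.Build algC V W *:%R rho rho_lin).
have ker0 : (U :&: lker (linfun Rho) = 0)%VS.
  apply/eqP; rewrite -subv0; apply/subvP => c; rewrite memv_cap memv_ker lfunE memv0.
  move=> /andP[/inv_cyclesP[c0 cinv _] /eqP/ffunP rc]; apply/eqP/ffunP => C; rewrite ffunE.
  have [CS|/c0//] := boolP (C \in chains S).
  have oO : orbit act H C \in Om by apply: imset_f.
  have := rc (enum_rank_in oO (orbit act H C)); rewrite !ffunE /ev enum_rankK_in //.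
  by case/imsetP: (repP _ oO) => h hH ->; rewrite cinv.
have img : (linfun Rho @: U = fullv)%VS.
  apply/eqP; rewrite eqEsubv subvf; apply/subvP => d _; apply/memv_imgP.
  pose c : V := [ffun C => \sum_(i < #|Om|) d i *+ (C \in ev i)].
  have cE C i : C \in ev i -> c C = d i.
    move=> Ci; rewrite ffunE (bigD1 i) //= Ci mulr1n big1 ?addr0 // => j ji.
    have [Cj|] := boolP (C \in enum_val j); last by rewrite mulr0n.
    case/eqP: ji; apply: enum_val_inj.
    exact: etrans (orbitE _ _ (evP j) Cj) (esym (orbitE _ _ (evP i) Ci)).
  exists c; last first.
    by rewrite lfunE; apply/ffunP => i; rewrite [RHS]ffunE (cE _ i) // repP.
  apply/inv_cyclesP; split.
  - move=> C CS; rewrite ffunE big1 // => i _.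
    have [Ci|] := boolP (C \in ev i); last by rewrite mulr0n.
    by rewrite (chainE _ _ (evP i) Ci) in CS.
  - move=> h C hH; rewrite !ffunE; apply: eq_bigr => i _; congr (_ *+ _).
    case/imsetP: (evP i) => B _ ->.
    by rewrite orbit_actr.
  by move=> t; rewrite in_set0.
rewrite -(limg_ker_dim (linfun Rho) U) ker0 dimv0 img dimvf add0n.
by rewrite /dim /= card_ord muln1.
Qed.

(** The trace of a permutation matrix counts fixed points, so the Cauchy-Frobenius formula
    applies. *)
Lemma cfdot_Res_perm (X : finType) (gT : finGroupType) (to : {action gT &-> X})
    (G K : {group gT}) (A : {set X}) (actsGA : [acts G, on A | to]) : K \subset G ->
  '['Res[K] (cfRepr (perm_repr actsGA)), 1] = #|orbit to K @: A|%:R.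
Proof.
move=> KG; rewrite cfdotE.
have KA : [acts K, on A | to] by apply: subset_trans actsGA.
have fixE h : h \in K ->
    'Res[K] (cfRepr (perm_repr actsGA)) h * ((1 : 'CF(K)) h)^* = #|('Fix_(A | to)[h])%g|%:R.
  move=> hK; rewrite cfResE // cfun1E hK conjC1 mulr1 cfunE (subsetP KG) // mulr1n.
  rewrite /mxtrace /=.
  rewrite (eq_bigr (fun i : 'I_#|A| => (to (enum_val i) h == enum_val i)%:R)); last first.
    by move=> i _; rewrite mxE.
  rewrite -(big_enum_val (fun x => (to x h == x)%:R : algC)) -natr_sum -sum1_card; congr _%:R.
  rewrite -big_mkcondr /=; apply: eq_bigl => x.
  by rewrite inE; congr (_ && _); apply/eqP/afix1P.
rewrite (eq_bigr _ fixE) -natr_sum Frobenius_Cauchy // natrM mulrC mulfK //.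
by rewrite pnatr_eq0 -lt0n cardG_gt0.
Qed.

End Multiplicity.

(** With [T = S] the alternating sum of [dim_inv_cycles] runs over all subsets of [S], as in [beta],
    and the terms are orbit counts on both sides. *)
Lemma b'_dim n (S : {set 'I_n.+1}) :
  {in S, forall r : 'I_n.+1, (rank (\bot%O : setpart n) < r < rank (\top%O : setpart n))%N} ->
  b' S = (\dim (inv_cycles (young n) S S))%:R.
Proof.
move=> hS; apply/esym/(etrans (dim_inv_cycles (young n) hS (subxx S))).
rewrite /b' /beta linear_sum cfdot_suml; apply: eq_big => [R|R _].
  by rewrite setDv sub0set.
by rewrite linearZ cfdotZl /alpha cfdot_Res_perm ?subsetT // dim_inv_chains.
Qed.

(** * Two orbits of growing chains *)

Section LowerBound.

Variable n : nat.
Implicit Types (x y z a b : setpart n) (C B Q : {set setpart n}) (S R T : {set 'I_n.+1}).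

Notation act := (chain_action n).

Lemma card_ord_gt k : #|[set u : 'I_n | (k < u)%N]| = (n - k.+1)%N.
Proof.
rewrite -sum1_card (eq_bigl (fun u : 'I_n => k < u)%N) => [|u]; last by rewrite inE.
by rewrite -(big_geq_mkord k.+1 n predT (fun=> 1%N)) sum_nat_const_nat muln1.
Qed.

Lemma rank_val x : rank x = #|[set u : 'I_n | [exists v : 'I_n, same x u v && (v < u)%N]]| :> nat.
Proof.
have vi : injective (@nat_of_ord n) := val_inj.
rewrite (rankE vi); apply: eq_card => u; rewrite [in RHS]inE.
by apply/(nonminP vi)/existsP => [[v ? ?]|[v /andP[]]]; exists v => //; apply/andP.
Qed.

(** The last [r + 1] points are put in one block; [n] is a key that no ordinal takes. *)
Definition tail_part r : setpart n :=
  kernel_part (fun u : 'I_n => if (n.-1 - r <= u)%N then n else nat_of_ord u).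

(** The block of the last point has one point less than in [tail_part r]; the rank is made up by
    joining the two smallest points. *)
Definition tail_pair_part r : setpart n :=
  kernel_part (fun u : 'I_n =>
    if (n - r <= u)%N then n else if (u <= 1)%N then 0%N else nat_of_ord u).

Lemma same_tail r u v :
  same (tail_part r) u v = (u == v) || ((n.-1 - r <= u)%N && (n.-1 - r <= v)%N).
Proof.
rewrite same_kernel -(inj_eq val_inj) /=; have := ltn_ord u; have := ltn_ord v.
by case: (leqP (n.-1 - r) u); case: (leqP (n.-1 - r) v) => /=; lia.
Qed.

Lemma same_tail_pair r u v : (1 <= r <= n - 2)%N ->
  same (tail_pair_part r) u v = [|| u == v, (n - r <= u)%N && (n - r <= v)%N |
    (u <= 1)%N && (v <= 1)%N].
Proof.
move=> hr; rewrite same_kernel -(inj_eq val_inj) /=; have := ltn_ord u; have := ltn_ord v.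
case: (leqP (n - r) u); case: (leqP (n - r) v) => /=; try lia.
all: case: (leqP u 1); case: (leqP v 1) => /=; lia.
Qed.

Lemma tail_bot : tail_part 0 = \bot%O.
Proof.
apply: eq_same => u v; rewrite same_tail same_bot -(inj_eq val_inj) /=.
by have := ltn_ord u; have := ltn_ord v; lia.
Qed.

Lemma tail_top r : (n.-1 <= r)%N -> tail_part r = \top%O.
Proof. by move=> h; apply: eq_same => u v; rewrite same_tail same_top; lia. Qed.

Lemma tail_le r s : (r <= s)%N -> (tail_part r <= tail_part s)%O.
Proof. by move=> rs; apply/le_sameP => u v; rewrite !same_tail; lia. Qed.

Lemma tail_le_pair r s : (r < s)%N -> (1 <= s <= n - 2)%N -> (tail_part r <= tail_pair_part s)%O.
Proof.
by move=> rs hs; apply/le_sameP => u v; rewrite same_tail same_tail_pair //; lia.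
Qed.

Lemma tail_pair_le r s : (1 <= r)%N -> (r <= s)%N -> (s <= n - 2)%N ->
  (tail_pair_part r <= tail_pair_part s)%O.
Proof.
by move=> r0 rs hs; apply/le_sameP => u v; rewrite !same_tail_pair; lia.
Qed.

Lemma le_rank_lt x y : (x <= y)%O -> (rank x < rank y)%N -> (x < y)%O.
Proof.
by move=> xy rxy; rewrite lt_neqAle xy andbT; apply: contraTneq rxy => ->; rewrite ltnn.
Qed.

Variable m : 'I_n.
Hypothesis hm : m = n.-1 :> nat.

Lemma rank_tail r : (r <= n.-1)%N -> rank (tail_part r) = r :> nat.
Proof.
move=> hr; rewrite rank_val -[RHS](_ : n - (n.-1 - r).+1 = r)%N; last by have := ltn_ord m; lia.
rewrite -card_ord_gt; apply: eq_card => u; rewrite !inE; apply/existsP/idP => [[v]|hu].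
  by rewrite same_tail -(inj_eq val_inj) /=; lia.
have kn : (n.-1 - r < n)%N by have := ltn_ord u; lia.
by exists (Ordinal kn); rewrite same_tail -(inj_eq val_inj) /=; lia.
Qed.

Lemma rank_bot : rank (\bot%O : setpart n) = 0%N :> nat.
Proof. by rewrite -tail_bot rank_tail. Qed.

Lemma rank_top : rank (\top%O : setpart n) = n.-1 :> nat.
Proof. by rewrite -(tail_top (leqnn _)) rank_tail. Qed.

Lemma rank_tail_pair r : (1 <= r <= n - 2)%N -> rank (tail_pair_part r) = r :> nat.
Proof.
move=> hr; rewrite rank_val.
have n1 : (1 < n)%N by lia. 
have n0 : (0 < n)%N by lia. 
have kn : (n - r < n)%N by lia.
transitivity #|Ordinal n1 |: [set u : 'I_n | (n - r < u)%N]|; last first.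
  by rewrite cardsU1 card_ord_gt inE /=; lia.
apply: eq_card => u; rewrite !inE; apply/existsP/idP => [[v]|].
  by rewrite same_tail_pair // -!(inj_eq val_inj) /=; lia.
rewrite -(inj_eq val_inj) /= => /orP[/eqP u1|hu].
  by exists (Ordinal n0); rewrite same_tail_pair // -(inj_eq val_inj) /=; lia.
by exists (Ordinal kn); rewrite same_tail_pair // -(inj_eq val_inj) /=; lia.
Qed.

Lemma grows_tail r s : (r < s)%N -> (s <= n.-1)%N -> grows m (tail_part r) (tail_part s).
Proof.
move=> rs sn; have kn : (n.-1 - s < n)%N by have := ltn_ord m; lia.
by apply/existsP; exists (Ordinal kn); rewrite !same_tail -(inj_eq val_inj) /= hm; lia.
Qed.

(** The marked block has [r + 1] points in [tail_part r] but only [s] points in [tail_pair_part s],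
    hence the form of the bound. *)
Lemma grows_tail_tail_pair r s : (r.+1 < s)%N -> (s <= n - 2)%N ->
  grows m (tail_part r) (tail_pair_part s).
Proof.
move=> rs sn; have kn : (n - s < n)%N by lia.
apply/existsP; exists (Ordinal kn); rewrite same_tail same_tail_pair; last by lia.
by rewrite -(inj_eq val_inj) /= hm; lia.
Qed.

Lemma grows_tail_pair r s : (1 <= r)%N -> (r < s)%N -> (s <= n - 2)%N ->
  grows m (tail_pair_part r) (tail_pair_part s).
Proof.
move=> r0 rs sn; have kn : (n - s < n)%N by lia.
apply/existsP; exists (Ordinal kn); rewrite !same_tail_pair; try lia.
by rewrite -(inj_eq val_inj) /= hm; lia.
Qed.

Lemma growing_imset S (F : 'I_n.+1 -> setpart n) :
  (forall r, r \in S -> [/\ rank (F r) = r, (1 <= r <= n - 2)%N & grows m \bot%O (F r)]) ->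
  (forall r s, r \in S -> s \in S -> (r < s)%N -> (F r <= F s)%O /\ grows m (F r) (F s)) ->
  [/\ [set F r | r in S] \in chains S, growing m \bot%O [set F r | r in S] &
      forall r, r \in S -> member [set F r | r in S] r = F r].
Proof.
move=> h1 h2.
have FS : [set F r | r in S] \in chains_above \bot%O S.
  apply/chains_aboveP; split.
  - move=> _ /imsetP[r rS ->]; have [rF hr _] := h1 r rS.
    by split; apply: le_rank_lt; rewrite ?le0x ?lex1 // ?rank_bot ?rank_top rF; lia.
  - move=> _ _ /imsetP[r rS ->] /imsetP[s sS ->].
    case: (ltngtP r s) => [rs|sr|/val_inj->]; last exact: comparablexx.
      by apply: le_comparable; case: (h2 r s).
    by apply: ge_comparable; case: (h2 s r).
  rewrite -imset_comp -[RHS]imset_id; apply: eq_in_imset => r /h1[].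
  by [].
split; first by rewrite -chains_above_bot.
  move=> z a /imsetP[s sS ->]; rewrite in_setU1 => /orP[/eqP->|/imsetP[r rS ->]] lt.
    by case: (h1 s sS).
  have := rank_lt lt; have [-> _ _] := h1 r rS; have [-> _ _] := h1 s sS => rs.
  by case: (h2 r s).
move=> r rS; have [rF _ _] := h1 r rS.
by rewrite -{1}rF (member_eq FS) // imset_f.
Qed.

Definition base_chain S := [set tail_part r | r : 'I_n.+1 in S].

Lemma base_chainP S : {in S, forall r : 'I_n.+1, (1 <= r <= n - 2)%N} ->
  [/\ base_chain S \in chains S, growing m \bot%O (base_chain S) &
      forall r, r \in S -> member (base_chain S) r = tail_part r].
Proof.
move=> hS; apply: growing_imset => [r /hS hr|r s /hS hr /hS hs rs]; split=> //.
- by apply: val_inj; apply: rank_tail; lia.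
- by rewrite -tail_bot; apply: grows_tail; lia.
- by apply: tail_le; lia.
- by apply: grows_tail; lia.
Qed.

(** The chain switches to the pair form at rank [p]. As [p - 1] is positive and not in [S], the
    marked block still grows at the switch. *)
Lemma second_chainP S p : {in S, forall r : 'I_n.+1, (1 <= r <= n - 2)%N} ->
  (1 < p)%N -> {in S, forall r : 'I_n.+1, r.+1 != p :> nat} ->
  let C := [set (if (r < p)%N then tail_part r else tail_pair_part r) | r : 'I_n.+1 in S] in
  [/\ C \in chains S, growing m \bot%O C &
      forall r, r \in S -> member C r = if (r < p)%N then tail_part r else tail_pair_part r].
Proof.
move=> hS p1 hp; apply: growing_imset => [r rS|r s rS sS rs].
  have hr := hS r rS; split=> //; case: ifP => rp.
  - by apply: val_inj; apply: rank_tail; lia.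
  - by apply: val_inj; apply: rank_tail_pair; lia.
  - by rewrite -tail_bot; apply: grows_tail; lia.
  - by rewrite -tail_bot; apply: grows_tail_tail_pair; lia.
have hr := hS r rS; have hs := hS s sS; have := hp r rS.
case: (ltnP r p) => rp; case: (ltnP s p) => sp rp'; try lia.
- by split; [apply: tail_le; lia | apply: grows_tail; lia].
- by split; [apply: tail_le_pair; lia | apply: grows_tail_tail_pair; lia].
- by split; [apply: tail_pair_le; lia | apply: grows_tail_pair; lia].
Qed.

Variable H : {group 'S_n}.
Hypothesis Hm : forall h : 'S_n, h \in H -> h m = m.

Lemma grows_permute a z (h : 'S_n) : h m = m -> grows m a z -> grows m (permute a h) (permute z h).
Proof.
move=> hm' /existsP[u /andP[zu au]]; apply/existsP; exists (h u).
by rewrite -{1 2}hm' !same_permute zu.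
Qed.

Lemma growing_act C (h : 'S_n) : h \in H -> growing m \bot%O C -> growing m \bot%O (act C h).
Proof.
move=> hH gC _ a /imsetP[z zC ->] aC lt /=.
have [a' a'C aE] : exists2 a', a' \in \bot%O |: C & a = permute a' h.
  move: aC; rewrite in_setU1 => /orP[/eqP->|/imsetP[a' a'C ->]].
    by exists \bot%O; rewrite ?setU11 ?permute_bot.
  by exists a'; rewrite // in_setU1 a'C orbT.
move: lt; rewrite aE /= lt_permute => lt.
exact: grows_permute (Hm hH) (gC _ _ zC a'C lt).
Qed.

(** [H] fixes [m] and so permutes the growing chains; averaging therefore keeps the prescribed
    values. *)
Lemma inv_cycle_on_growing S (f : {set setpart n} -> algC) :
  {in S, forall r : 'I_n.+1, (1 <= r <= n - 2)%N} ->
  (forall h C, h \in H -> f (act C h) = f C) ->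
  exists2 c, c \in inv_cycles H S S &
    forall C, C \in chains S -> growing m \bot%O C -> c C = f C.
Proof.
move=> hS finv; have [|c [c0 hc hcf]] := @growing_cycle n algC m \bot%O S f.
  by move=> r /hS; rewrite rank_bot rank_top; lia.
exists (average H c).
  by apply: average_cycle hc => C CS; apply: c0; rewrite chains_above_bot.
have cE C h : C \in chains S -> growing m \bot%O C -> h \in H -> c (act C h) = f C.
  move=> CS gC hH; rewrite hcf ?finv //; last exact: growing_act.
  by rewrite chains_above_bot act_chains.
move=> C CS gC; rewrite average_id; first by rewrite hcf // chains_above_bot.
move=> h hH; rewrite cE // -(cE C 1%g) ?act1 //; exact: group1.
Qed.

Notation V := {ffun {set setpart n} -> algC^o}.

Lemma inv_cycle_orbit S C0 :
  {in S, forall r : 'I_n.+1, (1 <= r <= n - 2)%N} ->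
  exists2 c, c \in inv_cycles H S S &
    forall C, C \in chains S -> growing m \bot%O C -> c C = (C \in orbit act H C0)%:R.
Proof.
move=> hS; apply: inv_cycle_on_growing => // h C hH.
by rewrite orbit_actr.
Qed.

Lemma inv_cycles_base S : {in S, forall r : 'I_n.+1, (1 <= r <= n - 2)%N} ->
  exists2 c, c \in inv_cycles H S S & c (base_chain S) = 1.
Proof.
move=> hS; have [CS gC _] := base_chainP hS.
have [c cZ cE] := inv_cycle_orbit (base_chain S) hS.
by exists c => //; rewrite cE // orbit_refl.
Qed.

(** The indicator functions of the orbits of the two chains extend to cycles, which are independent
    as soon as the orbits differ. *)
Lemma dim_inv_cycles_gt1 S p : {in S, forall r : 'I_n.+1, (1 <= r <= n - 2)%N} ->
  (1 < p)%N -> p \in [seq nat_of_ord r | r in S] ->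
  {in S, forall r : 'I_n.+1, r.+1 != p :> nat} ->
  (1 < \dim (inv_cycles H S S))%N.
Proof.
move=> hS p1 /imageP[q qS qp] hp.
have [BS gB hB] := base_chainP hS.
have /= := second_chainP hS p1 hp; set C := [set _ | _ in _] => -[CS gC hC].
have hq := hS q qS.
have CB : C \notin orbit act H (base_chain S).
  (* An element of [H] would carry [tail_part q] to [tail_pair_part q]. The latter joins the two
     smallest points apart from the marked block, whereas the nontrivial block of the former
     contains [m]. *)
  apply/negP => /imsetP[h hH CE].
  have : permute (tail_part q) h \in C.
    by rewrite CE; apply/imsetP; exists (tail_part q); rewrite // imset_f.
  have CS' : C \in chains_above \bot%O S by rewrite chains_above_bot.
  move=> /(member_eq CS'); rewrite rank_permute.
  have -> : rank (tail_part q) = q by apply: val_inj; apply: rank_tail; lia.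
  rewrite hC // qp ltnn => e.
  have n0 : (0 < n)%N by lia.
  have n1 : (1 < n)%N by lia.
  pose u0 := Ordinal n0; pose u1 := Ordinal n1.
  have : same (tail_pair_part q) u0 u1 by rewrite same_tail_pair //= orbT.
  have : ~~ same (tail_pair_part q) m u0.
    by rewrite same_tail_pair // -(inj_eq val_inj) /= hm; lia.
  rewrite e -(Hm hH) -[u0](permKV h) -[u1](permKV h) !same_permute !same_tail hm.
  by rewrite (inj_eq perm_inj) -(inj_eq val_inj) /=; lia.
have [c1 c1Z c1E] := inv_cycle_orbit (base_chain S) hS.
have [c2 c2Z c2E] := inv_cycle_orbit C hS.
have BC : base_chain S \notin orbit act H C by rewrite orbit_sym.
have fr : free [:: c1; c2].
  rewrite free_cons seq1_free span_seq1; apply/andP; split.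
    apply/vlineP => -[k e]; have := c1E _ BS gB; rewrite e ffunE c2E // (negPf BC) orbit_refl.
    by rewrite scaler0 => /eqP; rewrite eq_sym oner_eq0.
  apply/eqP => e; have := c2E _ CS gC; rewrite e ffunE orbit_refl => /eqP.
  by rewrite eq_sym oner_eq0.
have <- : \dim <<[:: c1; c2]>> = 2%N by move: fr; rewrite /free => /eqP.
apply: dimvS; apply/span_subvP => c; rewrite !inE => /orP[] /eqP-> //.
Qed.

End LowerBound.

(** * Vanishing of cycles on initial rank sets *)

Section Merge.

Variable n : nat.
Implicit Types (x y z : setpart n) (a b u v : 'I_n) (h : 'S_n).

Lemma same_pblock x u v : same x u v = (pblock x u == pblock x v).
Proof.
apply/idP/eqP => [uv|e]; last by rewrite /same e; apply: same_refl.
by apply/setP => t; apply: same_transl uv.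
Qed.

Definition merge x a b : setpart n :=
  kernel_part (fun u => if same x u b then pblock x a else pblock x u).

Lemma same_merge x a b u v : same (merge x a b) u v =
  same x u v || ((same x u a || same x u b) && (same x v a || same x v b)).
Proof.
rewrite same_kernel; case ub: (same x u b); case vb: (same x v b); rewrite -?same_pblock.
- by rewrite same_refl !orbT.
- rewrite orbT orbF [same x a v]same_sym /=; apply/esym/orb_idl => uv.
  by rewrite -(same_transl _ uv) ub in vb.
- rewrite orbT orbF andbT /=; apply/esym/orb_idl => uv.
  by rewrite (same_transl _ uv) vb in ub.
rewrite !orbF; apply/esym/orb_idr => /andP[ua va].
by rewrite (same_transl _ ua) same_sym.
Qed.

Lemma merge_sym x a b : merge x a b = merge x b a.
Proof.
apply: eq_same => u v.
by rewrite !same_merge orbC [X in _ || (_ && X)]orbC [X in X && _]orbC orbC.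
Qed.

Lemma merge_le x a b y : (x <= y)%O -> same y a b -> (merge x a b <= y)%O.
Proof.
move=> xy ab; apply/le_sameP => u v; rewrite same_merge => /orP[/(le_same xy)//|].
have key t : same x t a || same x t b -> same y t a.
  by case/orP => /(le_same xy) // tb; apply: same_trans tb _; rewrite same_sym.
by case/andP => /key ua /key va; apply: same_trans ua _; rewrite same_sym.
Qed.

Lemma merge_gt x a b : ~~ same x a b -> (x < merge x a b)%O.
Proof.
move=> ab; rewrite lt_neqAle; apply/andP; split; last first.
  by apply/le_sameP => u v uv; rewrite same_merge uv.
apply: contraNneq ab => ->.
by rewrite same_merge !same_refl !orbT.
Qed.

Lemma cover_merge x y a b : (x <= y)%O -> rank y = (rank x).+1 :> nat ->
  same y a b -> ~~ same x a b -> y = merge x a b.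
Proof.
move=> xy ry yab xab; have := merge_le xy yab; rewrite le_eqVlt => /orP[/eqP->//|/rank_lt].
by have := rank_lt (merge_gt xab); rewrite ry; lia.
Qed.

Lemma permute_merge x a b h : permute (merge x a b) h = merge (permute x h) (h a) (h b).
Proof.
apply: eq_same => u v; rewrite -[u](permKV h) -[v](permKV h).
by rewrite same_permute !same_merge !same_permute.
Qed.

Definition single x a := [forall u, same x a u == (a == u)].

Lemma singleP x a : reflect (forall u, same x a u = (a == u)) (single x a).
Proof. exact: 'forall_eqP. Qed.

Lemma single_le x y a : (x <= y)%O -> single y a -> single x a.
Proof.
move=> xy /singleP ya; apply/singleP => u; apply/idP/eqP => [/(le_same xy)|<-].
  by rewrite ya => /eqP.
exact: same_refl.
Qed.

Lemma permute_fix x h : (forall u v, same x (h u) (h v) = same x u v) -> permute x h = x.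
Proof.
move=> hx; apply: eq_same => u v; rewrite -[u](permKV h) -[v](permKV h) same_permute.
by rewrite hx.
Qed.

Lemma permute_tperm_same x a b : same x a b -> permute x (tperm a b) = x.
Proof.
move=> ab; have key u : same x (tperm a b u) u.
  by case: tpermP => [->|->|_ _]; rewrite ?same_refl // same_sym.
apply: permute_fix => u v; rewrite (same_transl _ (key u)) same_sym.
by rewrite (same_transl _ (key v)) same_sym.
Qed.

Lemma permute_tperm_single x a b : single x a -> single x b -> permute x (tperm a b) = x.
Proof.
move=> /singleP xa /singleP xb; apply: permute_fix => u v.
have xa' t : same x t a = (t == a) by rewrite same_sym xa eq_sym.
have xb' t : same x t b = (t == b) by rewrite same_sym xb eq_sym.
case: (tpermP a b u) => [->|->|/eqP ua /eqP ub].
- by rewrite xa xb -(inj_eq (@perm_inj _ (tperm a b))) tpermR tpermK.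
- by rewrite xa xb -(inj_eq (@perm_inj _ (tperm a b))) tpermL tpermK.
case: (tpermP a b v) => [->|->|_ _] //.
- by rewrite xa' xb' (negPf ua) (negPf ub).
- by rewrite xa' xb' (negPf ua) (negPf ub).
Qed.

End Merge.

Local Opaque same merge single.

(** * Chains of rank set {1, ..., i}, level by level *)

Section UpperBound.

Variables (n : nat) (m : 'I_n) (i : nat).
Hypothesis hm : m = n.-1 :> nat.
Hypothesis hi : (i <= n - 2)%N.
Hypothesis n_gt1 : (1 < n)%N.
Variable H : {group 'S_n}.
Hypothesis HmP : forall h : 'S_n, h m = m -> h \in H.
Implicit Types (x y z : setpart n) (a b u v : 'I_n) (h : 'S_n) (C B : {set setpart n}).

Notation act := (chain_action n).

Variable S : {set 'I_n.+1}.
Hypothesis SE : forall k, (k \in S) = (1 <= k <= i)%N.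

Let S_bound : {in S, forall r : 'I_n.+1, (1 <= r <= n - 2)%N}.
Proof. by move=> r; rewrite SE; lia. Qed.

(** Chains are extended by the bottom at level 0 and by the top beyond level [i], so that levels 1
    to [i] have neighbours. Steps between levels up to [i] are covers; the step from level [i] to
    the top may be longer. *)
Definition level C (j : nat) :=
  if j == 0%N then \bot%O else if (j <= i)%N then member C (inord j) else \top%O : setpart n.

Lemma inord_S j : (1 <= j <= i)%N -> inord j \in S /\ (inord j : 'I_n.+1) = j :> nat.
Proof.
move=> hj; have e : (inord j : 'I_n.+1) = j :> nat by apply: inordK; move: hi n_gt1; lia.
by rewrite SE e.
Qed.

Lemma level_mem C j : C \in chains S -> (1 <= j <= i)%N ->
  level C j \in C /\ rank (level C j) = j :> nat.
Proof.
rewrite -chains_above_bot => CS hj; have [jS e] := inord_S hj.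
rewrite /level ifN; last by lia.
by case/andP: (hj) => _ ->; have [? r] := memberP CS jS; rewrite r.
Qed.

Lemma level0 C : level C 0 = \bot%O.
Proof. by []. Qed.

Lemma level_in C j : (1 <= j <= i)%N -> level C j = member C (inord j).
Proof. by case/andP; rewrite /level; case: j => // j _ ->. Qed.

Lemma level_out C j : (i < j)%N -> level C j = \top%O.
Proof. by move=> ij; rewrite /level (gtn_eqF (leq_ltn_trans (leq0n i) ij)) leqNgt ij. Qed.

Lemma rank_level C j : C \in chains S -> (j <= i)%N -> rank (level C j) = j :> nat.
Proof.
move=> CS ji; have [->|j0] := eqVneq j 0%N; first by rewrite /level eqxx (rank_bot hm).
by case: (@level_mem C j CS) => //; lia.
Qed.

Lemma level_rank C z : C \in chains S -> z \in C -> level C (rank z) = z.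
Proof.
rewrite -chains_above_bot => CS zC; have := chain_rank CS zC; rewrite SE => hr.
rewrite /level ifN; last by lia.
by case/andP: hr => _ ->; rewrite inord_val (member_eq CS zC).
Qed.

Lemma level_lt C j k : C \in chains S -> (j < k)%N -> (k <= i.+1)%N -> (level C j < level C k)%O.
Proof.
move=> CS jk ki; have CS' : C \in chains_above \bot%O S by rewrite chains_above_bot.
have [k0|k1] : (k <= i)%N \/ k = i.+1 by lia.
  have [kC kr] : level C k \in C /\ rank (level C k) = k :> nat by apply: level_mem => //; lia.
  have [j0|j0] := eqVneq j 0%N.
    by rewrite j0 {1}/level eqxx; case/chains_aboveP: CS' => /(_ _ kC)[].
  have [jC jr] : level C j \in C /\ rank (level C j) = j :> nat by apply: level_mem => //; lia.
  by rewrite (chain_lt CS' jC kC) jr kr.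
rewrite k1 (level_out C (ltnSn i)); apply: le_rank_lt; first exact: lex1.
by rewrite rank_level // ?(rank_top hm); lia.
Qed.

Lemma level_le C j k : C \in chains S -> (j <= k)%N -> (level C j <= level C k)%O.
Proof.
move=> CS; rewrite leq_eqVlt => /orP[/eqP->//|jk].
have [ki|ki] := leqP k i.+1; first exact: ltW (level_lt CS jk ki).
by rewrite (level_out C (ltnW ki)) lex1.
Qed.

Lemma level_sub C B : C \in chains S -> B \in chains S ->
  (forall j, (1 <= j <= i)%N -> level C j = level B j) -> C = B.
Proof.
move=> CS BS h; have [CS' BS'] : C \in chains_above \bot%O S /\ B \in chains_above \bot%O S.
  by rewrite chains_above_bot.
apply: (chain_sub_eq CS' BS'); apply/subsetP => z zC.
have := chain_rank CS' zC; rewrite SE => hr.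
by rewrite -(level_rank CS zC) h //; case: (level_mem BS hr).
Qed.

Lemma level_act C h j : C \in chains S -> level (act C h) j = permute (level C j) h.
Proof.
move=> CS; have [j0|j0] := eqVneq j 0%N; first by rewrite j0 /level eqxx permute_bot.
have [ji|ji] := leqP j i; last by rewrite !level_out // permute_top.
have [jC jr] : level C j \in C /\ rank (level C j) = j :> nat by apply: level_mem => //; lia.
have hCS : act C h \in chains S by rewrite act_chains.
rewrite -{1}jr -(rank_permute h); apply: (level_rank hCS).
by apply/imsetP; exists (level C j).
Qed.

Local Opaque level chains chains_above select inv_cycles.

Section Vanishing.

Variable c : {ffun {set setpart n} -> algC^o}.
Hypothesis cZ : c \in inv_cycles H S S.

Lemma level_perm C B h : C \in chains S -> B \in chains S -> h m = m ->
  (forall j, level B j = permute (level C j) h) -> c B = c C.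
Proof.
move=> CS BS hmm e; have -> : B = act C h.
  by apply: level_sub; rewrite ?act_chains // => j _; rewrite level_act.
by have /inv_cyclesP[_ -> ] := cZ; last exact: HmP.
Qed.

(* In a fill-in relation whose other terms are [0] or [c C], the term [c C]
   occurs with a positive coefficient. *)
Lemma level_relation C j : C \in chains S -> (1 <= j <= i)%N ->
  (forall B, B \in chains S -> (forall k, k != j -> level B k = level C k) ->
     c B = 0 \/ c B = c C) -> c C = 0.
Proof.
move=> CS hj h; have [jS je] := inord_S hj.
have CS' : C \in chains_above \bot%O S by rewrite chains_above_bot.
have /inv_cyclesP[_ _ /(_ _ jS)] := cZ; set t := inord j in jS je *.
have BS : select C (S :\ t) \in chains_above \bot%O (S :\ t).
  by apply: select_chain CS' _; apply: subsetDl.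
move=> /(_ _ BS); rewrite /hat (bigD1 C) /=; last by rewrite CS' select_subset.
move=> s0; apply/eqP; apply: contraTT isT => cC.
have : 1 + \sum_(B in chains_above \bot%O S | (select C (S :\ t) \subset B) && (B != C))
    (c B / c C) = 0 :> algC.
  move/(congr1 (fun a : algC => a / c C)): s0; rewrite mul0r mulrDl divff // => s0.
  rewrite -[RHS]s0; congr (_ + _); rewrite mulr_suml; apply: eq_bigl => B; by rewrite andbA.
move=> e; have : (0 : algC) < 0; last by rewrite ltxx.
rewrite -[X in _ < X]e ltr_pwDl // sumr_ge0 // => B /andP[BS' /andP[sB _]].
have BS2 : B \in chains S by rewrite -chains_above_bot.
suff /(h _ BS2)[->|->] : forall k, k != j -> level B k = level C k by rewrite ?mul0r ?divff ?ler01.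
move=> k kj; have [k0|k0] := eqVneq k 0%N; first by rewrite k0 !level0.
have [ki|ki] := leqP k i; last by rewrite !level_out.
have [kC kr] : level C k \in C /\ rank (level C k) = k :> nat.
  by apply: level_mem => //; clear -k0 ki; lia.
have kB : level C k \in B.
  apply: (subsetP sB); rewrite inE kC in_setD1 (chain_rank CS' kC) andbT.
  by apply: contraNneq kj => e'; rewrite -kr e' je.
by rewrite -{1}kr (level_rank BS2 kB).
Qed.

(** For a cover of [tail_part] this is the only alternative to enlarging the marked block, as
    [first_growth] shows. *)
Definition pairstep x z := [exists a, exists b,
  [&& a != b, a != m, b != m, single x a, single x b & z == merge x a b]].

Lemma pairstepP x z : reflect
  (exists a b, [/\ a != b, a != m /\ b != m, single x a, single x b & z = merge x a b])
  (pairstep x z).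
Proof.
apply: (iffP existsP) => [[a /existsP[b /and5P[ab am bm xa /andP[xb /eqP z_]]]]|].
  by exists a, b.
move=> [a [b [ab [am bm] xa xb z_]]].
by exists a; apply/existsP; exists b; rewrite ab am bm xa xb z_ eqxx.
Qed.

Local Opaque pairstep.

Lemma single_tail r a : (r <= n.-1)%N -> ~~ same (tail_part n r) m a -> single (tail_part n r) a.
Proof.
move=> rn; rewrite same_tail => h; apply/singleP => u; rewrite same_tail.
move: h; rewrite -!(inj_eq val_inj) /= hm; have := ltn_ord a; lia.
Qed.

(** The transposition of [b] and [b'] conjugates one chain into the other: both points are
    singletons below level [j] and lie in one block above it. *)
Lemma level_swap C B j x y a b b' : C \in chains S -> B \in chains S -> (1 <= j <= i)%N ->
  (forall k, k != j -> level B k = level C k) ->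
  x = level C j.-1 -> y = level C j.+1 -> b != m -> b' != m -> a != b -> a != b' ->
  single x a -> single x b -> single x b' -> same y b b' ->
  level C j = merge x a b -> level B j = merge x a b' -> c B = c C.
Proof.
move=> CS BS hj BC xE yE bm b'm ab ab' xa xb xb' ybb Cj Bj.
apply: (level_perm (h := tperm b b')) => //; first by rewrite tpermD.
move=> k; case: (ltngtP k j) => [kj|jk|->].
- have kx : (level C k <= x)%O by rewrite xE; apply: level_le => //; clear -kj hj; lia.
  rewrite (BC k (negbT (ltn_eqF kj))) permute_tperm_single //.
    exact: single_le xb.
  exact: single_le xb'.
- have yk : (y <= level C k)%O by rewrite yE; apply: level_le.
  rewrite (BC k (negbT (gtn_eqF jk))) permute_tperm_same //; exact: le_same ybb.
by rewrite Bj Cj permute_merge permute_tperm_single // tpermL tpermD // eq_sym.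
Qed.

(** Above level [i] there is only the top, so two disjoint pairs can be exchanged by two
    transpositions that fix the other levels. *)
Lemma level_swap2 C B x a b a' b' : C \in chains S -> B \in chains S -> (1 <= i)%N ->
  (forall k, k != i -> level B k = level C k) ->
  x = level C i.-1 -> [/\ a != m, b != m, a' != m & b' != m] ->
  [/\ a != a', a != b', b != a' & b != b'] -> a != b -> a' != b' ->
  [/\ single x a, single x b, single x a' & single x b'] ->
  level C i = merge x a b -> level B i = merge x a' b' -> c B = c C.
Proof.
move=> CS BS i0 BC xE [am bm a'm b'm] [aa' ab' ba' bb'] ab ab'' [xa xb xa' xb'] Cj Bj.
apply: (level_perm (h := (tperm a a' * tperm b b')%g)) => //; first by rewrite permM !tpermD.
move=> k; rewrite permuteM; case: (ltngtP k i) => [kj|jk|->].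
- have kx : (level C k <= x)%O by rewrite xE; apply: level_le => //; clear -kj i0; lia.
  rewrite (BC k (negbT (ltn_eqF kj))).
  by rewrite !permute_tperm_single //; apply: (single_le kx).
- rewrite (BC k (negbT (gtn_eqF jk))).
  by rewrite !level_out // !permute_top.
rewrite Bj Cj !permute_merge !permute_tperm_single // tpermL.
have -> : tperm a a' b = b by rewrite tpermD // eq_sym.
by rewrite tpermL tpermD // eq_sym.
Qed.

(** Pairs with a common point are handled by [level_swap], disjoint pairs at level [i] by
    [level_swap2]. *)
Lemma pairsteps_equal C B j x : C \in chains S -> B \in chains S -> (1 <= j <= i)%N ->
  (forall k, k != j -> level B k = level C k) -> x = level C j.-1 ->
  pairstep x (level C j) -> pairstep x (level B j) ->
  ((j < i)%N -> ~~ pairstep (level C j) (level C j.+1)) -> c B = c C.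
Proof.
move=> CS BS hj BC xE /pairstepP[a [b [ab [am bm] xa xb Cj]]].
move=> /pairstepP[a' [b' [ab' [a'm b'm] xa' xb' Bj]]] np.
set y := level C j.+1.
have Cy : (level C j <= y)%O by apply: level_le.
have By : (level B j <= y)%O.
  by rewrite /y -(BC j.+1 (negbT (gtn_eqF (ltnSn j)))) level_le.
have yab : same y a b by apply: (le_same Cy); rewrite Cj same_merge !same_refl !orbT.
have yab' : same y a' b' by apply: (le_same By); rewrite Bj same_merge !same_refl !orbT.
have swap := level_swap CS BS hj BC xE (erefl y).
have [e|aa'] := eqVneq a a'.
  subst a'; apply: (swap a b b') => //.
  by apply: same_trans yab'; rewrite same_sym.
have [e|ab''] := eqVneq a b'.
  subst b'; apply: (swap a b a'); rewrite // 1?merge_sym // 1?eq_sym //.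
  by apply: (same_trans (v := a)); rewrite same_sym.
have [e|ba'] := eqVneq b a'.
  subst a'; apply: (swap b a b'); rewrite // 1?merge_sym // 1?eq_sym //.
  exact: same_trans yab yab'.
have [e|bb'] := eqVneq b b'.
  subst b'; apply: (swap b a a') => //; try by rewrite merge_sym.
  - by rewrite eq_sym.
  - by apply: (same_trans yab); rewrite same_sym.
(* For [j < i], level [j + 1] covers level [j] and joins [a'] and [b'], which are still singletons
   at level [j]. This would be a further pair step, which is excluded. *)
have [ji|ji] : (j < i)%N \/ j = i by clear -hj; lia.
  case/negP: (np ji); apply/pairstepP; exists a', b'.
  have sC t : single x t -> a != t -> b != t -> single (level C j) t.
    move=> /singleP xt ta tb; apply/singleP => u; rewrite Cj same_merge !xt.
    by rewrite [t == a]eq_sym [t == b]eq_sym (negPf ta) (negPf tb) /= orbF.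
  split=> //; [exact: sC | exact: sC |].
  apply: cover_merge => //; first by rewrite !rank_level //; clear -hj; lia.
  by have /singleP -> := sC a' xa' aa' ba'.
by subst j; case/andP: hj => i0 _; apply: (@level_swap2 C B x a b a' b').
Qed.

(** If the marked block does not grow, two newly joined points both lie outside it and hence are
    singletons of [tail_part n r]. *)
Lemma first_growth C r : C \in chains S -> (r < i)%N -> level C r = tail_part n r ->
  ~~ pairstep (level C r) (level C r.+1) ->
  exists2 u, ~~ same (tail_part n r) m u & level C r.+1 = merge (tail_part n r) m u.
Proof.
move=> CS ri Cr np; set z := level C r.+1 in np *; set x := tail_part n r in Cr *.
have xz : (x < z)%O by rewrite -Cr; apply: level_lt => //; clear -ri; lia.
have rz : rank z = (rank x).+1 :> nat by rewrite -Cr !rank_level //; clear -ri; lia.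
have [/existsP[u /andP[zu xu]]|no] := boolP [exists u, same z m u && ~~ same x m u].
  by exists u => //; apply: cover_merge (ltW xz) rz zu xu.
have nog u : same z m u -> same x m u.
  by move=> zu; apply: contraNT no => xu; apply/existsP; exists u; rewrite zu.
have [a /existsP[b /andP[zab xab]]] : exists a, [exists b, same z a b && ~~ same x a b].
  apply/existsP; apply: contraTT xz => h; apply/negP => /lt_geF/negP; apply.
  apply/le_sameP => u v zuv; apply: contraNT h => xuv.
  by apply/existsP; exists u; apply/existsP; exists v; rewrite zuv.
have key u v : same z u v -> ~~ same x u v -> ~~ same x m u.
  move=> zuv; apply: contra => xmu; have xmv : same x m v.
    by apply/nog/(same_trans (le_same (ltW xz) xmu)).
  by rewrite -(same_transl _ xmu).
have xma := key a b zab xab.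
have xmb : ~~ same x m b by apply: (key b a); rewrite same_sym.
case/negP: np; rewrite Cr; apply/pairstepP; exists a, b.
have rn : (r <= n.-1)%N by clear -ri hi; lia.
split; [| | exact: single_tail | exact: single_tail | exact: cover_merge (ltW xz) rz zab xab].
- by apply: contraNneq xab => ->; apply: same_refl.
- by split; [apply: contraNneq xma | apply: contraNneq xmb] => ->; apply: same_refl.
Qed.

(** The outer induction is on the number [d] of levels not known to follow [tail_part], the inner
    one on the number [k] of pair steps after level [r]. *)
Lemma inv_cycle_vanish : c (base_chain S) = 0 -> c = 0.
Proof.
move=> c0; have /inv_cyclesP[coff cinv _] := cZ.
have [bS _ bE] := base_chainP hm S_bound.
suff main d r : (r + d)%N = i -> forall C, C \in chains S ->
    (forall j, (j <= r)%N -> level C j = tail_part n j) -> c C = 0.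
  apply/ffunP => C; rewrite ffunE; have [CS|/coff//] := boolP (C \in chains S).
  apply: (main i 0%N) => // j; rewrite leqn0 => /eqP->.
  by rewrite level0 tail_bot.
elim: d r => [|d IH] r rd C CS hC.
  suff -> : C = base_chain S by [].
  apply: level_sub => // j hj; have [jS je] := inord_S hj.
  rewrite hC; last by clear -hj rd; lia.
  by rewrite level_in // bE // je.
have rdS : (r.+1 + d)%N = i by rewrite addSnnS.
have inner k B : B \in chains S -> (forall j, (j <= r)%N -> level B j = tail_part n j) ->
    (r + k <= i)%N ->
    (forall j, (r <= j < r + k)%N -> pairstep (level B j) (level B j.+1)) ->
    ((r + k < i)%N -> ~~ pairstep (level B (r + k)%N) (level B (r + k)%N.+1)) -> c B = 0.
  elim: k B => [|k IHk] B BS hB rk hpair hnot.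
    rewrite !addn0 in hnot; have ri : (r < i)%N by rewrite -rdS leq_addr.
    have [u xu zE] := first_growth BS ri (hB r (leqnn r)) (hnot ri).
    set x := tail_part n r in xu zE.
    (* [a0] is the point that [tail_part n r.+1] adds to the marked block. A transposition moves [u]
       there, and the outer induction applies. *)
    have a0n : (n.-1 - r.+1 < n)%N by clear -n_gt1; lia.
    pose a0 := Ordinal a0n.
    have xa0 : ~~ same x m a0 by rewrite same_tail -(inj_eq val_inj) /= hm; clear -ri hi n_gt1; lia.
    have tE : tail_part n r.+1 = merge x m a0.
      apply: cover_merge => //; first by apply: tail_le.
        by rewrite !(rank_tail hm) //; clear -ri hi; lia.
      by rewrite same_tail -(inj_eq val_inj) /= hm; clear -ri hi n_gt1; lia.
    have um : u != m by apply: contraNneq xu => ->; apply: same_refl.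
    have a0m : a0 != m by apply: contraNneq xa0 => ->; apply: same_refl.
    have rn : (r <= n.-1)%N by clear -ri hi; lia.
    have [xs xs0] := (single_tail rn xu, single_tail rn xa0).
    have fixm : tperm u a0 m = m by rewrite tpermD.
    rewrite -(cinv (tperm u a0) B) ?HmP //.
    apply: (IH r.+1 rdS); rewrite ?act_chains // => j; rewrite leq_eqVlt => /orP[/eqP->|jr].
      by rewrite level_act // zE permute_merge permute_tperm_single // tpermL fixm.
    have jx : (tail_part n j <= x)%O by apply: tail_le.
    by rewrite level_act // hB // permute_tperm_single //; apply: (single_le jx).
  have hj : (1 <= r + k.+1 <= i)%N by rewrite rk addnS.
  (* The gap relation at the last pair step: a filling that again makes a pair step has the value of
     [B]; any other one gives a chain with only [k] pair steps, where [c] vanishes by induction. *)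
  apply: (level_relation BS hj) => D DS DB.
  have xE : level B (r + k.+1)%N.-1 = level D (r + k)%N by rewrite DB addnS //; clear; lia.
  have [pD|npD] := boolP (pairstep (level D (r + k)%N) (level D (r + k)%N.+1)).
    right; apply: (@pairsteps_equal B D (r + k.+1)%N (level B (r + k.+1)%N.-1)) => //.
      by rewrite addnS; apply: hpair; clear; lia.
    by rewrite xE addnS.
  left; apply: IHk => //.
  - by move=> j jr; rewrite DB ?hB //; clear -jr; lia.
  - by clear -rk; lia.
  - by move=> j jr; rewrite !DB ?hpair //; clear -jr; lia.
(* The least such [k] counts the pair steps directly after level [r], stopping at level [i] at the
   latest. *)
pose P k := (r + k == i)%N || ~~ pairstep (level C (r + k)%N) (level C (r + k)%N.+1).
have exP : exists k, P k by exists d.+1; rewrite /P rd eqxx.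
case: (ex_minnP exP) => k Pk kmin.
have below j : (r <= j < r + k)%N -> (j != i) && pairstep (level C j) (level C j.+1).
  move=> hj; have := contraNN (kmin (j - r)%N); rewrite /P subnKC; last by case/andP: hj.
  by rewrite -ltnNge negb_or negbK; apply; clear -hj; lia.
have ki : (r + k <= i)%N by have := kmin d.+1; rewrite /P rd eqxx => /(_ isT); clear -rd; lia.
apply: (inner k) => //; first by move=> j /below/andP[].
by move: Pk => /orP[/eqP->|//]; rewrite ltnn.
Qed.

End Vanishing.

End UpperBound.

(** * The Young subgroup, the shape of the rank set, and the conclusion *)

Section Young.

Variables (n : nat) (m : 'I_n).
Hypothesis hm : m = n.-1 :> nat.

Lemma youngP (h : 'S_n) : (h \in young n) = (h m == m).
Proof.
have mN : m \notin [set u : 'I_n | (u < n.-1)%N] by rewrite inE hm ltnn.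
rewrite inE; apply/idP/eqP => [hY|hmm]; first exact: out_perm hY mN.
apply/subsetP => u; rewrite !inE => hu.
have um : u != m by apply: contraNneq hu => ->; rewrite hmm.
by move: um; rewrite -(inj_eq val_inj) /= hm; have := ltn_ord u; lia.
Qed.

End Young.

(** A gap is an element [p > 1] of [S] whose predecessor is missing. Without gaps, membership
    descends from the maximum of [S] to 1. *)
Lemma initial_or_gap n (S : {set 'I_n.+1}) :
  {in S, forall r : 'I_n.+1, (1 <= r <= n - 2)%N} ->
  (exists i : nat, (0 <= i <= n - 2)%N /\ S = [set k : 'I_n.+1 | (1 <= k <= i)%N]) \/
  (exists p, [/\ (1 < p)%N, p \in [seq nat_of_ord r | r in S] &
    {in S, forall r : 'I_n.+1, r.+1 != p :> nat}]).
Proof.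
move=> hS; pose gap (p : 'I_n.+1) := (1 < p)%N && [forall r in S, r.+1 != p :> nat].
have [/exists_inP[p pS /andP[p1 /forall_inP hp]]|no] := boolP [exists p in S, gap p].
  by right; exists p; split=> //; apply/imageP; exists p.
(* For empty [S] the maximum is 0, which is the case [i = 0]. *)
left; pose i := (\max_(r in S) r)%N; exists i.
have iS (r : 'I_n.+1) : r \in S -> (r <= i)%N by move=> rS; apply: leq_bigmax_cond.
have i_le : (i <= n - 2)%N by apply/bigmax_leqP => r /hS/andP[].
split=> //; apply/setP => k; rewrite inE; apply/idP/idP => [kS|/andP[k1 ki]].
  by rewrite iS // andbT; case/andP: (hS k kS).
have key d (j : 'I_n.+1) : (j + d)%N = i -> (0 < j)%N -> j \in S.
  elim: d j => [|d IH] j jd j0.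
    rewrite addn0 in jd; have S0 : (0 < #|S|)%N.
      apply/card_gt0P/set0Pn; apply: contraTneq j0 => SE.
      by rewrite jd /i SE big_set0.
    have [r rS ir] := eq_bigmax_cond (fun r : 'I_n.+1 => nat_of_ord r) S0.
    by suff -> : j = r by []; apply: val_inj; exact: etrans jd ir.
  have jn : (j.+1 < n.+1)%N by clear -jd i_le; lia.
  have jS : Ordinal jn \in S by apply: IH => //=; rewrite -jd addSnnS.
  move: no; rewrite negb_exists_in => /forall_inP/(_ _ jS).
  rewrite negb_and /= -leqNgt ltnS leqNgt j0 /= negb_forall_in => /exists_inP[r rS].
  by rewrite negbK eqSS => /eqP/val_inj <-.
by apply: (key (i - k)%N); rewrite ?subnKC.
Qed.

(* {1, ..., n-2} is seen inside 'I_n.+1 = {0, ..., n}. *)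
Theorem theorem4p5 (n : nat) (S : {set 'I_n.+1}) (hn : (3 <= n)%N)
    (hS : S \subset [set k : 'I_n.+1 | (1 <= k <= n - 2)%N]) :
  ((exists i : nat, (0 <= i <= n - 2)%N /\
      S = [set k : 'I_n.+1 | (1 <= k <= i)%N]) -> b' S = 1) /\
  (~ (exists i : nat, (0 <= i <= n - 2)%N /\
      S = [set k : 'I_n.+1 | (1 <= k <= i)%N]) -> 1 < b' S).
Proof.
have mn : (n.-1 < n)%N by lia.
pose m := Ordinal mn; have hm : m = n.-1 :> nat by [].
have S_bound : {in S, forall r : 'I_n.+1, (1 <= r <= n - 2)%N}.
  by move=> r /(subsetP hS); rewrite inE.
have fixm (h : 'S_n) : h \in young n -> h m = m by rewrite (youngP hm) => /eqP.
have -> : b' S = (\dim (inv_cycles (young n) S S))%:R.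
  apply: b'_dim => r /S_bound; rewrite (rank_bot hm) (rank_top hm); clear -hn; lia.
split=> [[i [/andP[_ hi] SE]]|notinit]; last first.
  have [//|[p [p1 pS hp]]] := initial_or_gap S_bound.
  by rewrite ltr1n; apply: (dim_inv_cycles_gt1 hm fixm S_bound p1 pS hp).
have [c cZ c1] := inv_cycles_base hm fixm S_bound.
(* An invariant cycle [d] and the multiple of [c] by the value of [d] on the base chain agree on
   that chain, so their difference vanishes. *)
suff -> : inv_cycles (young n) S S = <[c]>%VS.
  rewrite dim_vline; suff -> : c != 0 by [].
  by apply: contraTneq isT => c0; move/eqP: c1; rewrite c0 ffunE eq_sym oner_eq0.
apply/eqP; rewrite eqEsubv; apply/andP; split; apply/subvP => d; last first.
  by case/vlineP => k ->; apply: memvZ.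
move=> dZ; apply/vlineP; exists (d (base_chain S)); apply/eqP; rewrite -subr_eq0; apply/eqP.
have n1 : (1 < n)%N by lia.
have SE' k : (k \in S) = (1 <= k <= i)%N by rewrite SE inE.
have yH (h : 'S_n) : h m = m -> h \in young n by rewrite (youngP hm) => /eqP.
apply: (inv_cycle_vanish hm hi n1 yH SE'); first by apply: memvB => //; apply: memvZ.
rewrite !ffunE c1; apply/eqP; rewrite subr_eq0; apply/eqP/esym; exact: mulr1.
Qed.
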